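(* Let $\varphi\colon \mathbb{C}^*\times\mathbb{C}^n\to\mathbb{C}^n$ be a holomorphic action of $\mathbb{C}^*$ on $\mathbb{C}^n$ having $p\in\mathbb{C}^n$ as a fixed point, and let $\psi\colon\mathbb{C}^*\times\mathbb{C}^n\to\mathbb{C}^n$ be the action by linear transformations defined by the derivative of $\varphi$ at $p$, i.e. $\psi^z(x)=D\varphi^z(p)\cdot x$. Then there is an entire (holomorphic on all of $\mathbb{C}^n$) map $F\colon\mathbb{C}^n\to\mathbb{C}^n$ such that $F(p)=0$ and $$\psi^z\circ F\equiv F\circ\varphi^z\quad\text{for each } z\in\mathbb{C}^*.$$ Moreover, there is a $\varphi$-invariant open set $W\ni p$ in $\mathbb{C}^n$ such that $F|_W\colon W\to F(W)$ is a biholomorphism.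
   Context: A holomorphic action of $\mathbb{C}^*$ on a complex manifold $M$ is a holomorphic map $\varphi\colon\mathbb{C}^*\times M\to M$ with $\varphi(1,x)=x$ and $\varphi(zw,x)=\varphi(z,\varphi(w,x))$. For $z\in\mathbb{C}^*$ write $\varphi^z=\varphi(z,\cdot)$. A fixed point $p$ satisfies $\varphi^z(p)=p$ for all $z$. Here $D\varphi^z(p)$ is the complex derivative (Jacobian matrix) of $\varphi^z$ at $p$, and $\psi^z=\psi(z,\cdot)$. *)

(* Defs.v *)
(* C = R[i] (complex numbers over a realType R),
   C^n = Cn R n := 'rV[R[i]]_n.  Holomorphic = complex (R[i]-linear) Frechet
   differentiable, i.e. `differentiable` over the scalar field R[i]. *)
From mathcomp Require Import all_boot all_algebra.
From mathcomp Require Import all_classical all_reals all_analysis.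
From mathcomp Require Import order complex.
Import Order.TTheory GRing.Theory Num.Theory numFieldNormedType.Exports.
Local Open Scope ring_scope.
Local Open Scope classical_set_scope.

Definition Cn (R : realType) (n : nat) : normedModType R[i] := 'rV[R[i]]_n.
Definition CxCn (R : realType) (n : nat) : normedModType R[i] :=
  ((R[i])^o * Cn R n)%type.

Definition slice {R : realType} {n : nat}
  (phi : CxCn R n -> Cn R n) (z : R[i]) : Cn R n -> Cn R n :=
  fun x => phi (z, x).

Definition holomorphic_on {R : realType} {n m : nat}
  (f : Cn R n -> Cn R m) (U : set (Cn R n)) : Prop :=
  forall x, U x -> differentiable f x.

(* phi : C^* x C^n -> C^n is a holomorphic action of C^*
   (values of phi at z = 0 are irrelevant) *)
Definition holomorphic_Cstar_action {R : realType} {n : nat}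
  (phi : CxCn R n -> Cn R n) : Prop :=
  [/\ (forall (z : R[i]) x, z != 0 -> differentiable phi ((z : (R[i])^o), x)),
      (forall x, phi (1, x) = x) &
      (forall (z w : R[i]) x, z != 0 -> w != 0 ->
          phi (z * w, x) = phi (z, phi (w, x)))].

Definition fixed_point {R : realType} {n : nat}
  (phi : CxCn R n -> Cn R n) (p : Cn R n) : Prop :=
  forall z : R[i], z != 0 -> phi (z, p) = p.

Definition linearized_action {R : realType} {n : nat}
  (phi : CxCn R n -> Cn R n) (p : Cn R n) (z : R[i])
  : Cn R n -> Cn R n :=
  fun x => 'd (slice phi z) p x.

Definition phi_invariant {R : realType} {n : nat}
  (phi : CxCn R n -> Cn R n) (W : set (Cn R n)) : Prop :=
  forall (z : R[i]) x, z != 0 -> W x -> W (phi (z, x)).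

Definition biholomorphic_on {R : realType} {n : nat}
  (F : Cn R n -> Cn R n) (W : set (Cn R n)) : Prop :=
  [/\ open W, open (F @` W), holomorphic_on F W &
      exists G : Cn R n -> Cn R n,
        [/\ holomorphic_on G (F @` W),
            (forall x, W x -> G (F x) = x) &
            (forall y, (F @` W) y -> F (G y) = y)]].

(* Main.v *)
(* The map is the Bochner average of x |-> psi^(1/z) (phi^z x - p) over the circle
   |z| = 1.  Writing z = exp w turns phi into a 2 pi i-periodic action of (C, +) by
   entire maps, and a circle mean into a mean over [0, 2 pi i].  Goursat's theorem
   on the parallelogram spanned by a and 2 pi i shows that the mean of a periodic
   entire function is unchanged by every complex translation a; this gives the
   equivariance of the average under all of C^*, and, letting Re a tend to minus
   infinity, the mean value property and Cauchy's estimates.  The latter control the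
   second-order remainder uniformly on the circle, so the average F is entire with
   derivative the averaged derivative, which is the identity at p.  Hence F is
   injective on a ball B around p and onto a neighbourhood of 0.

   Let V be a small neighbourhood of 0 invariant under the circle, U the preimage of
   V in B, and W the union of the phi^z U.  If y and psi^z y lie in V, the maximum
   principle on a strip keeps psi^(exp (t w)) y small for all t in [0, 1], where
   exp w = z.  So the arc phi^(exp (t w)) u, where u is in U and F u = y, never
   crosses the outer shell of B; its endpoint is in B, where F is injective.  This
   makes F injective on W. *)

(* Near [p] alone there is no difficulty: a map with derivative the identity at [p] is invertible on
   a small ball. The obstacle is invariance. An orbit may leave the ball B and come back elsewhere,
   so two points of the saturated set could share a value of F although F is injective on B. Bounds
   that are uniform on the circle say nothing about the noncompact radial direction; there the
   maximum principle on strips takes over, applied to the linear action. The shell exists because F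
   minus the identity is 1/2-Lipschitz on B, whence |x - p| <= 2 |F x| there: values of norm below a
   quarter of the radius are taken only in the inner half of B. By equivariance the image of W is
   the saturation of V under the linear action, so it is open because V is. Likewise the inverse of
   F at any point of W is conjugate, through the two actions, to the inverse on B, which reduces its
   differentiability to estimates on B. *)
Require Import Defs.
From HB Require Import structures.
From mathcomp Require Import all_boot all_algebra.
From mathcomp Require Import all_classical all_reals all_analysis.
From mathcomp Require Import order complex.
From mathcomp Require Import ring lra.
Import Order.TTheory GRing.Theory Num.Theory numFieldNormedType.Exports.
Set Implicit Arguments. Unset Strict Implicit. Unset Printing Implicit Defensive.
Local Open Scope ring_scope.
Local Open Scope classical_set_scope.
Local Open Scope complex_scope.

(* A synonym of [continuous] that the library's [Extern] hint for differentials,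
   costly to refute on concrete complex functions, does not match. *)
Definition cts (T : topologicalType) (U : nbhsType) (f : T -> U) : Prop := continuous f.

(** * Rules of continuity and differentiation over an abstract numeric field *)

Section AbstractField.
Variables (K : numFieldType) (T : topologicalType).

Lemma ctsD (W : normedModType K) (f g : T -> W) : cts f -> cts g ->
  cts (fun x => f x + g x).
Proof. by move=> cf cg x; apply: cvgD; [exact: cf|exact: cg]. Qed.

Lemma ctsN (W : normedModType K) (f : T -> W) : cts f ->
  cts (fun x => - f x).
Proof. by move=> cf x; apply: cvgN; exact: cf. Qed.

Lemma ctsB (W : normedModType K) (f g : T -> W) : cts f -> cts g ->
  cts (fun x => f x - g x).
Proof. by move=> cf cg x; apply: cvgB; [exact: cf|exact: cg]. Qed.

Lemma ctsZ (W : normedModType K) (k : T -> K^o) (f : T -> W) :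
  cts k -> cts f -> cts (fun x => k x *: f x).
Proof. by move=> ck cf x; apply: cvgZ; [exact: ck|exact: cf]. Qed.

Lemma ctsM (f g : T -> K^o) : cts f -> cts g ->
  cts (fun x => f x * g x : K^o).
Proof. by move=> cf cg; exact: ctsZ. Qed.

Lemma cts_cst (W : normedModType K) (c : W) : cts (fun _ : T => c).
Proof. by move=> x; exact: cvg_cst. Qed.

Variable V : normedModType K.

Lemma diff_mul (f g : V -> K^o) x : differentiable f x -> differentiable g x ->
  differentiable (fun y => f y * g y : K^o) x.
Proof. by move=> df dg; exact: differentiableM. Qed.

Lemma diff_sum (W : normedModType K) n (f : 'I_n -> V -> W) x :
  (forall i, differentiable (f i) x) -> differentiable (fun y => \sum_i f i y) x.
Proof.
move=> df; rewrite (_ : (fun y => _) = \sum_i f i); first exact: differentiable_sum.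
by apply/funext => y; rewrite fct_sumE.
Qed.

Lemma diff_add (W : normedModType K) (f g : V -> W) x :
  differentiable f x -> differentiable g x -> differentiable (fun y => f y + g y) x.
Proof. by move=> df dg; exact: differentiableD. Qed.

Lemma diff_sub (W : normedModType K) (f g : V -> W) x :
  differentiable f x -> differentiable g x -> differentiable (fun y => f y - g y) x.
Proof. by move=> df dg; exact: differentiableB. Qed.

Lemma diff_add_cst (a x : V) : differentiable (fun y : V => a + y) x.
Proof. by apply: diff_add; [exact: differentiable_cst|exact: ex_diff]. Qed.

Lemma diff_opp (W : normedModType K) (f : V -> W) x :
  differentiable f x -> differentiable (fun y => - f y) x.
Proof. by move=> df; exact: differentiableN. Qed.

Lemma diff_id (x : V) : differentiable (fun y : V => y) x.
Proof. exact: ex_diff. Qed.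

Lemma is_diff_affine (W : normedModType K) (x v : W) (w : K^o) :
  is_diff w (fun t : K^o => x + t *: v) ( *:%R^~ v).
Proof.
have := is_diffD (is_diff_cst x w) (is_diff_scalel w v).
by rewrite (_ : 0 + _ = *:%R^~ v)//; apply/funext => y; rewrite fctE add0r.
Qed.

Lemma diff_subE (W : normedModType K) (f g : V -> W) x v :
  differentiable f x -> differentiable g x ->
  'd (fun y => f y - g y) x v = 'd f x v - 'd g x v.
Proof. by move=> df dg; have /= -> := congr1 (@^~ v) (diffB df dg). Qed.

Lemma diff_addE (W : normedModType K) (f g : V -> W) x v :
  differentiable f x -> differentiable g x ->
  'd (fun y => f y + g y) x v = 'd f x v + 'd g x v.
Proof. by move=> df dg; have /= -> := congr1 (@^~ v) (diffD df dg). Qed.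

Lemma diff_cstE (W : normedModType K) (c : W) (x v : V) :
  'd (fun _ : V => c) x v = 0.
Proof. by have /= -> := congr1 (@^~ v) (diff_cst c x). Qed.

Lemma diff_idE (x v : V) : 'd (fun y : V => y) x v = v.
Proof. by rewrite (@diff_val _ _ _ _ _ _ id (is_diff_id x)). Qed.

Lemma diff_translate (W : normedModType K) (f : V -> W) a x :
  differentiable f (a + x) -> differentiable (fun y => f (a + y)) x.
Proof. by move=> df; exact: (differentiable_comp (diff_add_cst a x) df). Qed.

Lemma diff_translateE (W : normedModType K) (f : V -> W) a x v :
  differentiable f (a + x) -> 'd (fun y => f (a + y)) x v = 'd f (a + x) v.
Proof.
move=> df; have /= -> := congr1 (@^~ v) (diff_comp (diff_add_cst a x) df).
by rewrite diff_addE ?diff_cstE ?add0r ?diff_idE.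
Qed.

Lemma diff_coord n (j : 'I_n) (x : 'rV[K]_n) :
  differentiable (fun y : 'rV[K]_n => y ord0 j : K^o) x.
Proof. exact: differentiable_coord. Qed.

End AbstractField.

(** * Real-valued norms on complex normed modules *)

Section Norm.
Variable R : realType.
Local Notation C := (R[i]^o : normedModType R[i]).

(** The norm of a normed module over [R[i]] takes its values in [R[i]]. They are real, so the real
    part loses nothing and opens the estimates to real arithmetic. *)
Definition nrm (V : normedModType R[i]) (x : V) : R := complex.Re `|x|.

Lemma nrmE (V : normedModType R[i]) (x : V) : `|x| = (nrm x)%:C.
Proof. by rewrite /nrm RRe_real// ger0_real. Qed.

Lemma nrm_ge0 (V : normedModType R[i]) (x : V) : 0 <= nrm x.
Proof. by rewrite -ler0c -nrmE. Qed.

Lemma nrm0 (V : normedModType R[i]) : nrm (0 : V) = 0.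
Proof. by rewrite /nrm normr0. Qed.

Lemma nrm_eq0 (V : normedModType R[i]) (x : V) : nrm x = 0 -> x = 0.
Proof. by move=> h; apply/eqP; rewrite -normr_eq0 nrmE h. Qed.

Lemma nrm_gt0 (V : normedModType R[i]) (x : V) : x != 0 -> 0 < nrm x.
Proof.
move=> x0; rewrite lt_neqAle nrm_ge0 andbT eq_sym.
by apply: contra x0 => /eqP/nrm_eq0 ->.
Qed.

Lemma nrmD (V : normedModType R[i]) (x y : V) : nrm (x + y) <= nrm x + nrm y.
Proof. by rewrite -lecR rmorphD /= -!nrmE ler_normD. Qed.

Lemma nrmN (V : normedModType R[i]) (x : V) : nrm (- x) = nrm x.
Proof. by rewrite /nrm normrN. Qed.

Lemma nrm_distC (V : normedModType R[i]) (x y : V) : nrm (x - y) = nrm (y - x).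
Proof. by rewrite /nrm distrC. Qed.

Lemma nrmB (V : normedModType R[i]) (x y : V) : nrm (x - y) <= nrm x + nrm y.
Proof. by rewrite -(nrmN y) nrmD. Qed.

Lemma nrm_tri (V : normedModType R[i]) (z x y : V) :
  nrm (x - y) <= nrm (x - z) + nrm (z - y).
Proof. by rewrite -(subrKA z x); exact: nrmD. Qed.
 
Lemma nrmZ (V : normedModType R[i]) (c : C) (x : V) : nrm (c *: x) = nrm c * nrm x.
Proof. by apply: complexI; rewrite rmorphM /= -!nrmE normrZ. Qed.

Lemma nrmM (c d : C) : nrm (c * d : C) = nrm c * nrm d.
Proof. by rewrite -nrmZ. Qed.

Lemma nrmV (c : C) : nrm (c^-1 : C) = (nrm c)^-1.
Proof. by apply: complexI; rewrite fmorphV /= -!nrmE normfV. Qed.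

Lemma nrmR (r : R) : nrm (r%:C : C) = `|r|.
Proof. by rewrite /nrm normc_def /= expr0n addr0 sqrtr_sqr. Qed.

Lemma nrm1 : nrm (1 : C) = 1.
Proof. by rewrite -[1]/(1%:C) nrmR normr1. Qed.

Lemma nrm_Re (z : C) : `|complex.Re z| <= nrm z.
Proof. by rewrite -lecR -nrmE normc_ge_Re. Qed.

Lemma nrm_Im (z : C) : `|complex.Im z| <= nrm z.
Proof.
have -> : nrm z = nrm (z * - 'i : C).
  by rewrite nrmM nrmN /nrm normc_def /= expr0n expr1n add0r sqrtr1 mulr1.
by apply: le_trans (nrm_Re _); rewrite mulrN raddfN /= ReiNIm opprK.
Qed.

Lemma nrm_sq (z : C) : nrm z ^+ 2 = complex.Re z ^+ 2 + complex.Im z ^+ 2.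
Proof. by apply: complexI; rewrite rmorphXn /= -nrmE -add_Re2_Im2. Qed.

Lemma nrm_le_ReIm (z : C) : nrm z <= `|complex.Re z| + `|complex.Im z|.
Proof.
rewrite {1}[z]complexE; apply: le_trans (nrmD (_ : C) _) _.
rewrite nrmR (nrmM 'i) nrmR.
by rewrite /nrm normc_def /= expr0n expr1n add0r sqrtr1 mul1r.
Qed.

Lemma nrm_conj (z : C) : nrm (z^*%C : C) = nrm z.
Proof. by rewrite /nrm normcJ. Qed.

Lemma Re_conjM (z : C) : complex.Re ((z^*%C : C) * z : C) = nrm z ^+ 2.
Proof. by rewrite nrm_sq; case: z => a b /=; ring. Qed.

(** The norm on row vectors is the sup norm; together with [nrm_vec_le] this reduces vector
    estimates to scalar ones without loss of constants. *)
Lemma nrm_coord n (x : Cn R n) j : nrm (x ord0 j : C) <= nrm x.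
Proof.
rewrite -lecR -!nrmE [leRHS]/Num.norm/= [leRHS]mx_normE.
exact: (le_bigmax _ (fun i => `|x i.1 i.2|%:nng) (ord0, j)).
Qed.

Lemma nrm_vec_le n (x : Cn R n) (r : R) : 0 <= r ->
  (forall j, nrm (x ord0 j : C) <= r) -> nrm x <= r.
Proof.
move=> r0 H; have r0' : 0 <= r%:C by rewrite ler0c.
have [->|/eqP x0] := eqVneq x 0; first by rewrite nrm0.
have [|[i j]] := @mx_norm_neq0 R[i] 1 n x.
  by apply/eqP => /mx_norm_eq0.
rewrite /= ord1 => e.
suff -> : nrm x = nrm (x ord0 j : C) by exact: H.
by apply: complexI; rewrite -!nrmE; exact: e.
Qed.

End Norm.

(** * Epsilon-delta characterisations with real norms *)

Section EpsDelta.
Variable R : realType.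
Local Notation C := (R[i]^o : normedModType R[i]).
Implicit Types V W : normedModType R[i].

Lemma gt0_cplx (e : R[i]) : 0 < e -> exists2 r : R, 0 < r & e = r%:C.
Proof.
move=> e0; exists (complex.Re e); last by rewrite RRe_real// gtr0_real.
by move: e0; rewrite ltcE => /andP[].
Qed.

Lemma nrm_normlt V (x : V) (r : R) : (`|x| < r%:C) = (nrm x < r).
Proof. by rewrite nrmE ltcR. Qed.

Lemma nbhs_nrmP V (x : V) (A : set V) :
  nbhs x A <-> exists2 d : R, 0 < d & forall y, nrm (y - x) < d -> A y.
Proof.
split.
  move/nbhs_normP => [e /= /gt0_cplx[d d0 ->] H]; exists d => // y yd.
  by apply: H => /=; rewrite distrC nrm_normlt.
move=> [d d0 H]; apply/nbhs_normP; exists d%:C; first by rewrite /= ltcR.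
by move=> y /=; rewrite distrC nrm_normlt; exact: H.
Qed.

Lemma cont_nrmP V W (f : V -> W) (x : V) : {for x, continuous f} <->
  forall e : R, 0 < e -> exists2 d : R, 0 < d &
    forall y, nrm (y - x) < d -> nrm (f y - f x) < e.
Proof.
split.
  move=> /cvgrPdist_lt H e e0.
  have /H /nbhs_nrmP[d d0 Hd] : 0 < e%:C by rewrite ltcR.
  by exists d => // y /Hd; rewrite distrC nrm_normlt.
move=> H; apply/cvgrPdist_lt => _ /gt0_cplx[e e0 ->].
have [d d0 Hd] := H _ e0; apply/nbhs_nrmP; exists d => // y /Hd.
by rewrite distrC nrm_normlt.
Qed.

Lemma contR_nrmP W (f : R -> W) (x : R) : {for x, continuous f} <->
  forall e : R, 0 < e -> exists2 d : R, 0 < d &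
    forall y, `|y - x| < d -> nrm (f y - f x) < e.
Proof.
split.
  move=> /cvgrPdist_lt H e e0.
  have /H /nbhs_normP[d d0 Hd] : 0 < e%:C by rewrite ltcR.
  exists d => // y yd; have /= := Hd y; rewrite distrC => /(_ yd).
  by rewrite distrC nrm_normlt.
move=> H; apply/cvgrPdist_lt => _ /gt0_cplx[e e0 ->].
have [d d0 Hd] := H _ e0; apply/nbhs_normP; exists d => // y /=.
by rewrite distrC => /Hd; rewrite distrC nrm_normlt.
Qed.

Lemma cont_realP V (f : V -> R) (x : V) : {for x, continuous f} <->
  forall e : R, 0 < e -> exists2 d : R, 0 < d &
    forall y, nrm (y - x) < d -> `|f y - f x| < e.
Proof.
split.
  move=> /cvgrPdist_lt H e e0.
  have /H /nbhs_nrmP[d d0 Hd] := e0.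
  by exists d => // y /Hd; rewrite distrC.
move=> H; apply/cvgrPdist_lt => e e0.
have [d d0 Hd] := H _ e0; apply/nbhs_nrmP; exists d => // y /Hd.
by rewrite distrC.
Qed.

Lemma nrm_pair_lt V W (x : V * W) (r : R) :
  (nrm (x : (V * W)%type) < r) = (nrm x.1 < r) && (nrm x.2 < r).
Proof.
rewrite -!nrm_normlt; case: x => a b /=.
rewrite {1}/Num.norm /= comparable_gt_max//.
by rewrite !nrmE /Order.comparable !lecR; case: ltgtP.
Qed.

Lemma diff_nrm V W (f : V -> W) (x : V) : differentiable f x ->
  forall e : R, 0 < e -> exists2 d : R, 0 < d &
    forall h, nrm h < d -> nrm (f (x + h) - f x - 'd f x h) <= e * nrm h.
Proof.
move=> /diff_locally /eqaddoP H e e0.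
have /H /nbhs_nrmP[d d0 Hd] : 0 < e%:C by rewrite ltcR.
exists d => // h hd; have := Hd h; rewrite subr0 => /(_ hd).
rewrite !nrmE -rmorphM lecR /=.
by rewrite !fctE /= opprD addrA (addrC h).
Qed.

Lemma nrm_bounded_linear_continuous V W (L : {linear V -> W}) (K : R) :
  (forall h, nrm (L h) <= K * nrm h) -> continuous L.
Proof.
move=> HK x; apply/cont_nrmP => e e0.
have K0 : 0 <= `|K| by [].
exists (e / (`|K| + 1)); first by rewrite divr_gt0//; lra.
move=> y; rewrite ltr_pdivlMr; last lra.
rewrite -raddfB => h; apply: le_lt_trans h.
apply: le_trans (HK _) _; have := nrm_ge0 (y - x); have := ler_norm K.
by nra.
Qed.

Lemma linear_nrm_bounded V W (L : {linear V -> W}) : continuous L ->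
  exists2 K : R, 0 < K & forall h, nrm (L h) <= K * nrm h.
Proof.
move=> /linear_lipschitz[_ /gt0_cplx[K K0 ->] H]; exists K => // h.
by have := H h; rewrite !nrmE -rmorphM lecR.
Qed.

(** Converse of [diff_nrm]. The bound by [K] supplies the continuity that a differential must
    have. *)
Lemma is_diff_nrm V W (f : V -> W) (L : {linear V -> W}) (K : R) (x : V) :
  (forall h, nrm (L h) <= K * nrm h) ->
  (forall e : R, 0 < e -> exists2 d : R, 0 < d &
    forall h, nrm h < d -> nrm (f (x + h) - f x - L h) <= e * nrm h) ->
  is_diff x f L.
Proof.
move=> /nrm_bounded_linear_continuous Lc H.
have E : f \o shift x = cst (f x) + L +o_ 0 id.
  apply/eqaddoP => _ /gt0_cplx[e e0 ->]; have [d d0 Hd] := H _ e0.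
  apply/nbhs_nrmP; exists d => // h; rewrite subr0 => /Hd.
  rewrite !nrmE -rmorphM lecR /=.
  by rewrite !fctE /= opprD addrA (addrC h).
have D := diff_unique Lc E.
split => //; apply/diff_locallyP.
by rewrite D.
Qed.

End EpsDelta.

(** * Integrals of complex-valued functions over real segments *)

Section ComplexIntegral.
Variable R : realType.
Local Notation C := (R[i]^o : normedModType R[i]).
Local Notation mu := (@lebesgue_measure R).
Implicit Types (u v : R -> R) (f g : R -> C) (a b : R).

Definition rint a b u : R := \int[mu]_(t in `[a, b]) u t.

Lemma continuous_integrable_itv u a b : cts u ->
  mu.-integrable `[a, b] (EFin \o u).
Proof.
move=> cu; apply: continuous_compact_integrable; first exact: segment_compact.
exact: continuous_subspaceT.
Qed.

Lemma eq_rint a b u v : (forall t, a <= t <= b -> u t = v t) ->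
  rint a b u = rint a b v.
Proof. by move=> uv; apply: eq_Rintegral => t; rewrite inE /= in_itv /= => /uv. Qed.

Lemma rintD a b u v : cts u -> cts v ->
  rint a b (fun t => u t + v t) = rint a b u + rint a b v.
Proof. by move=> cu cv; apply: RintegralD => //; exact: continuous_integrable_itv. Qed.

Lemma rintB a b u v : cts u -> cts v ->
  rint a b (fun t => u t - v t) = rint a b u - rint a b v.
Proof. by move=> cu cv; apply: RintegralB => //; exact: continuous_integrable_itv. Qed.

Lemma rintZ a b (r : R) u : cts u ->
  rint a b (fun t => r * u t) = r * rint a b u.
Proof. by move=> cu; apply: RintegralZl => //; exact: continuous_integrable_itv. Qed.

Lemma rint_cst a b (r : R) : a <= b -> rint a b (fun=> r) = r * (b - a).
Proof.
move=> ab; rewrite /rint Rintegral_cst//= lebesgue_measure_itv/= lte_fin.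
by case: ltgtP ab => // -> _; rewrite subrr.
Qed.

Lemma le_rint a b u v : cts u -> cts v ->
  (forall t, a <= t <= b -> u t <= v t) -> rint a b u <= rint a b v.
Proof.
move=> cu cv uv; by apply: le_Rintegral => //; exact: continuous_integrable_itv.
Qed.

Lemma rint_split a c b u : cts u -> a <= c -> c <= b ->
  rint a b u = rint a c u + rint c b u.
Proof.
move=> cu ac cb.
have iu x y := @continuous_integrable_itv u x y cu.
have := @Rintegral_itvB R u (BLeft a) (BRight b) c (iu a b).
rewrite !bnd_simp => /(_ ac cb) H.
have ic : mu.-integrable [set` Interval (BRight c) (BRight b)] (EFin \o u).
  by apply: integrableS (iu c b) => //; apply: subset_itvr; rewrite bnd_simp.
by rewrite /rint -(Rintegral_itv_obnd_cbnd ic) -H addrC subrK.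
Qed.

Definition cint a b f : C :=
  rint a b (fun t => complex.Re (f t)) +i* rint a b (fun t => complex.Im (f t)).

Lemma Re_sub (z w : R[i]) :
  complex.Re (z - w) = complex.Re z - complex.Re w.
Proof. by case: z w => ? ? []. Qed.

Lemma Im_sub (z w : R[i]) :
  complex.Im (z - w) = complex.Im z - complex.Im w.
Proof. by case: z w => ? ? []. Qed.

Lemma continuous_Re f : cts f -> cts (fun t => complex.Re (f t)).
Proof.
move=> cf x; apply/cvgrPdist_lt => e e0.
have /contR_nrmP/(_ _ e0)[d d0 H] := cf x.
apply/nbhs_normP; exists d => // y /=; rewrite distrC => /H.
by apply: le_lt_trans; rewrite -distrC -Re_sub; exact: nrm_Re.
Qed.

Lemma continuous_Im f : cts f -> cts (fun t => complex.Im (f t)).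
Proof.
move=> cf x; apply/cvgrPdist_lt => e e0.
have /contR_nrmP/(_ _ e0)[d d0 H] := cf x.
apply/nbhs_normP; exists d => // y /=; rewrite distrC => /H.
by apply: le_lt_trans; rewrite -distrC -Im_sub; exact: nrm_Im.
Qed.

Lemma eq_cint a b f g : (forall t, a <= t <= b -> f t = g t) ->
  cint a b f = cint a b g.
Proof. by move=> fg; congr Complex; apply: eq_rint => t /fg ->. Qed.

Lemma cintD a b f g : cts f -> cts g ->
  cint a b (fun t => f t + g t) = cint a b f + cint a b g.
Proof.
move=> cf cg; rewrite /cint.
have [cRf cRg] := (continuous_Re cf, continuous_Re cg).
have [cIf cIg] := (continuous_Im cf, continuous_Im cg).
apply/eqP; rewrite eq_complex /= -!rintD//; apply/andP; split; apply/eqP;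
  by apply: eq_rint => t _; case: (f t) (g t) => ? ? [].
Qed.

Lemma cintZ a b f (c : C) : cts f ->
  cint a b (fun t => c * f t : C) = c * cint a b f.
Proof.
move=> cf; rewrite /cint; case: c => p q.
have [cR cI] := (continuous_Re cf, continuous_Im cf).
have cM (r : R) u : cts u -> cts (fun t => r * u t).
  by move=> cu t; apply: cvgM; [exact: cvg_cst|exact: cu].
apply/eqP; rewrite eq_complex /= -!rintZ// -rintB// -?rintD//;
  do ?exact: cM.
by apply/andP; split; apply/eqP; apply: eq_rint => t _; case: (f t).
Qed.

Lemma cintN a b f : cts f -> cint a b (fun t => - f t) = - cint a b f.
Proof.
move=> cf; rewrite -mulN1r -cintZ//.
by apply: eq_cint => t _; rewrite mulN1r.
Qed.

Lemma cintB a b f g : cts f -> cts g ->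
  cint a b (fun t => f t - g t) = cint a b f - cint a b g.
Proof. by move=> cf cg; rewrite (cintD a b cf (ctsN cg)) (cintN a b cg). Qed.

Lemma cint_cst a b (c : C) : a <= b -> cint a b (fun=> c) = (b - a)%:C * c.
Proof.
move=> ab; rewrite /cint !rint_cst//.
by case: c => p q /=; apply/eqP; rewrite eq_complex /=; apply/andP; split;
  apply/eqP; ring.
Qed.

(** Multiplication by the conjugate of the integral [I] turns [nrm I ^+ 2] into the integral of a
    real part, which is at most [nrm I * K] pointwise. Bounding real and imaginary parts separately
    would lose a factor. *)
Lemma cint_bound a b f (K : R) : cts f -> a <= b ->
  (forall t, a <= t <= b -> nrm (f t) <= K) -> nrm (cint a b f) <= K * (b - a).
Proof.
move=> cf ab HK; set I := cint a b f.
have [I0|I0] := leP (nrm I) 0.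
  apply: le_trans I0 _; rewrite mulr_ge0 ?subr_ge0//.
  by apply: le_trans (HK a _); rewrite ?nrm_ge0// lexx.
have cg : cts (fun t => (I^*%C : C) * f t : C).
  move=> t; apply/contR_nrmP => e e0.
  have /contR_nrmP/(_ (e / nrm I))[|d d0 Hd] := cf t; first by rewrite divr_gt0.
  exists d => // y /Hd; rewrite -mulrBr nrmM nrm_conj.
  by rewrite ltr_pdivlMr// mulrC.
have E : nrm I ^+ 2 = rint a b (fun t => complex.Re ((I^*%C : C) * f t : C)).
  rewrite -Re_conjM; exact (congr1 _ (esym (cintZ a b (I^*%C : C) cf))).
have : nrm I ^+ 2 <= (nrm I * K) * (b - a).
  rewrite E -rint_cst//; apply: le_rint; first exact: continuous_Re.
    by move=> t; exact: cvg_cst.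
  move=> t /HK h.
  apply: le_trans (ler_norm _) _; apply: le_trans (nrm_Re _) _.
  by rewrite nrmM nrm_conj ler_wpM2l// nrm_ge0.
by rewrite expr2 -mulrA ler_pM2l.
Qed.

Lemma cint_split a c b f : cts f -> a <= c -> c <= b ->
  cint a b f = cint a c f + cint c b f.
Proof.
move=> cf ac cb.
by rewrite /cint !(@rint_split a c b)//; [exact: continuous_Im|exact: continuous_Re].
Qed.

End ComplexIntegral.

(** * Goursat's theorem on parallelograms *)

Section Goursat.
Variable R : realType.
Local Notation C := (R[i]^o : normedModType R[i]).

(** The intervals [[s k, s k + d k]] are nested, and the supremum of the left ends lies in all of
    them. *)
Lemma nested_point (s d : nat -> R) :
  (forall k, s k <= s k.+1) -> (forall k, s k.+1 + d k.+1 <= s k + d k) ->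
  (forall k, 0 <= d k) -> exists s0, forall k, s k <= s0 <= s k + d k.
Proof.
move=> s1 s2 d0.
have up m n : (m <= n)%N -> s m <= s n.
  by move=> /subnK <-; elim: (n - m)%N => // k /le_trans; apply; rewrite addSn.
have dn m n : (m <= n)%N -> s n + d n <= s m + d m.
  move=> /subnK <-; elim: (n - m)%N => // k IH; rewrite addSn.
  exact: le_trans (s2 _) IH.
have ub m n : s n <= s m + d m.
  case: (leqP m n) => mn; last by have := up _ _ (ltnW mn); have := d0 m; lra.
  by have := dn _ _ mn; have := d0 n; lra.
have sup1 : has_sup (range s).
  by split; [exists (s 0), 0|exists (s 0 + d 0) => _ [n _ <-]].
exists (sup (range s)) => k; apply/andP; split.
  by apply: ub_le_sup; [case: sup1|exists k].
by apply: sup_le_ub; [case: sup1|move=> _ [n _ <-]].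
Qed.

(** [Q s t d] speaks of the square with corner [(s, t)] and side [d]. If it failed on the unit
    square it would fail on some quarter, then on a quarter of that, and so on; the failing squares
    shrink to a point [(s0, t0)], where the second hypothesis is violated. *)
Lemma square_bisection (Q : R -> R -> R -> Prop) :
  (forall s t d, 0 < d -> Q s t (d / 2) -> Q (s + d / 2) t (d / 2) ->
     Q s (t + d / 2) (d / 2) -> Q (s + d / 2) (t + d / 2) (d / 2) -> Q s t d) ->
  (forall s0 t0, exists2 e, 0 < e & forall s t d, 0 < d < e ->
     s <= s0 <= s + d -> t <= t0 <= t + d -> Q s t d) ->
  Q 0 0 1.
Proof.
move=> Qsplit Qloc; apply: contrapT => nQ.
pose D (k : nat) : R := 2^-1 ^+ k.
have D0 k : 0 < D k by rewrite exprn_gt0.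
have DS k : D k.+1 = D k / 2 by rewrite /D exprSr.
(* The failure of [Q] is put inside the existential, as a premise, so that [choice] returns a total
   function to iterate. *)
have step (x : R * R * nat) : exists y : R * R,
    (~ Q x.1.1 x.1.2 (D x.2) -> [/\ ~ Q y.1 y.2 (D x.2.+1),
      x.1.1 <= y.1 <= x.1.1 + D x.2 / 2 & x.1.2 <= y.2 <= x.1.2 + D x.2 / 2]).
  case: x => [[s t] k] /=; rewrite DS; have := D0 k; move: (D k) => d d0.
  have [q|nq] := pselect (Q s t d); first by exists (s, t).
  have [q1|q1] := pselect (Q s t (d / 2)); last first.
    by exists (s, t) => _ /=; split => //; apply/andP; split; lra.
  have [q2|q2] := pselect (Q (s + d / 2) t (d / 2)); last first.
    by exists (s + d / 2, t) => _ /=; split => //; apply/andP; split; lra.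
  have [q3|q3] := pselect (Q s (t + d / 2) (d / 2)); last first.
    by exists (s, t + d / 2) => _ /=; split => //; apply/andP; split; lra.
  have [q4|q4] := pselect (Q (s + d / 2) (t + d / 2) (d / 2)); last first.
    by exists (s + d / 2, t + d / 2) => _ /=; split => //; apply/andP; split; lra.
  by exfalso; apply: nq; exact: Qsplit.
have [next nextP] := choice step.
pose c := fix c (k : nat) : R * R :=
  if k is k'.+1 then next (c k', k') else (0, 0).
have cQ k : ~ Q (c k).1 (c k).2 (D k).
  elim: k => [|k IH]; first by rewrite /D expr0.
  by have [] := nextP (c k, k) IH.
have cn k : [/\ ~ Q (c k.+1).1 (c k.+1).2 (D k.+1),
    (c k).1 <= (c k.+1).1 <= (c k).1 + D k / 2 &
    (c k).2 <= (c k.+1).2 <= (c k).2 + D k / 2].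
  exact: (nextP (c k, k) (cQ k)).
have [s0 s0P] : exists s0, forall k, (c k).1 <= s0 <= (c k).1 + D k.
  apply: nested_point => k; last exact: ltW.
    by have [_ /andP[]] := cn k.
  by have [_ /andP[_ ? _]] := cn k; rewrite DS; lra.
have [t0 t0P] : exists t0, forall k, (c k).2 <= t0 <= (c k).2 + D k.
  apply: nested_point => k; last exact: ltW.
    by have [_ _ /andP[]] := cn k.
  by have [_ _ /andP[_ ?]] := cn k; rewrite DS; lra.
have [e e0 He] := Qloc s0 t0.
have [k ke] : exists k, D k < e.
  have : (fun k => D k) @ \oo --> (0 : R).
    by apply: cvg_expr; rewrite ger0_norm; lra.
  move=> /cvgrPdist_lt/(_ _ e0)[k _ /(_ k (leqnn k))] /=.
  by rewrite sub0r normrN ger0_norm ?ltW//; exists k.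
by apply: (cQ k); apply: He; rewrite ?D0.
Qed.

Lemma continuous_line (h : C -> C) (z a : C) : cts h ->
  cts (fun s : R => h (z + s%:C * a)).
Proof.
move=> ch s; apply/contR_nrmP => e e0.
have /cont_nrmP/(_ _ e0)[d d0 Hd] := ch (z + s%:C * a).
have a0 := nrm_ge0 a.
exists (d / (nrm a + 1)); first by rewrite divr_gt0//; lra.
move=> y; rewrite ltr_pdivlMr; last lra.
move=> yd; apply: Hd.
have -> : z + y%:C * a - (z + s%:C * a) = (y - s)%:C * a :> C.
  by rewrite rmorphB /=; ring.
by rewrite nrmM nrmR; have := normr_ge0 (y - s); nra.
Qed.

(* The boundary integral of the parallelogram [z + [s, s + d] a + [t, t + d] b],
   run through starting with its side parallel to [a]. *)
Definition pgram_int (h : C -> C) (z a b : C) (s t d : R) : C :=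
  let P (s t : R) : C := z + s%:C * a + t%:C * b in
  a * cint s (s + d) (fun u => h (P u t) - h (P u (t + d))) +
  b * cint t (t + d) (fun v => h (P (s + d) v) - h (P s v)).

Lemma continuous_pgram (h : C -> C) (z a b : C) : cts h ->
  [/\ forall t : R, cts (fun s : R => h (z + s%:C * a + t%:C * b)) &
     forall s : R, cts (fun t : R => h (z + s%:C * a + t%:C * b))].
Proof.
move=> ch; split=> t; last exact: continuous_line.
rewrite (_ : (fun s : R => _) = (fun s : R => h ((z + t%:C * b) + s%:C * a))).
  exact: continuous_line.
by apply/funext => s; rewrite addrAC.
Qed.

Lemma pgram_intE (h : C -> C) (z a b : C) (s t d : R) : cts h ->
  let P (s t : R) : C := z + s%:C * a + t%:C * b in
  pgram_int h z a b s t d =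
  a * (cint s (s + d) (fun u => h (P u t)) -
       cint s (s + d) (fun u => h (P u (t + d)))) +
  b * (cint t (t + d) (fun v => h (P (s + d) v)) -
       cint t (t + d) (fun v => h (P s v))).
Proof.
move=> ch P; have [H1 H2] := continuous_pgram z a b ch.
by rewrite /pgram_int !cintB.
Qed.

(** Each inner side belongs to two quarters, which run through it in opposite directions, so only
    the outer boundary survives. *)
Lemma pgram_int_split (h : C -> C) (z a b : C) (s t d : R) : cts h ->
  0 < d -> let I s t := pgram_int h z a b s t (d / 2) in
  pgram_int h z a b s t d =
  I s t + I (s + d / 2) t + I s (t + d / 2) + I (s + d / 2) (t + d / 2).
Proof.
move=> ch d0 /=; rewrite !pgram_intE//.
have [H1 H2] := continuous_pgram z a b ch.
have half x : x + d / 2 + d / 2 = x + d by field.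
have le1 x : x <= x + d / 2 by lra.
have le2 x : x + d / 2 <= x + d by lra.
rewrite !half !(@cint_split _ s (s + d / 2) (s + d))//.
rewrite !(@cint_split _ t (t + d / 2) (t + d))//.
do ?[move: (cint _ _ _) => ?].
by ring.
Qed.

Lemma pgram_intD (f g : C -> C) (z a b : C) (s t d : R) : cts f -> cts g ->
  pgram_int (fun w => f w + g w) z a b s t d =
  pgram_int f z a b s t d + pgram_int g z a b s t d.
Proof.
move=> cf cg.
have [F1 F2] := continuous_pgram z a b cf.
have [G1 G2] := continuous_pgram z a b cg.
rewrite (pgram_intE z a b s t d (ctsD cf cg)) (pgram_intE z a b s t d cf).
rewrite (pgram_intE z a b s t d cg).
rewrite (cintD s (s + d) (F1 t) (G1 t)) (cintD s (s + d) (F1 (t + d)) (G1 (t + d))).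
rewrite (cintD t (t + d) (F2 (s + d)) (G2 (s + d))) (cintD t (t + d) (F2 s) (G2 s)).
do ?[move: (cint _ _ _) => ?].
by ring.
Qed.

(** The values of an affine function on opposite sides differ by a constant, so the two pairs of
    sides contribute [c1 * a * b * d ^+ 2] with opposite signs. *)
Lemma pgram_int_affine (z a b c0 c1 : C) (s t d : R) : 0 <= d ->
  pgram_int (fun w => c0 + c1 * w) z a b s t d = 0.
Proof.
move=> d0; rewrite /pgram_int.
have sd x : x <= x + d by lra.
have -> : cint s (s + d) (fun u => c0 + c1 * (z + u%:C * a + t%:C * b) -
    (c0 + c1 * (z + u%:C * a + (t + d)%:C * b))) = d%:C * - (c1 * d%:C * b).
  rewrite -[d in RHS](addrK s d) (addrC d) -cint_cst//.
  apply: eq_cint => u _; rewrite (rmorphD _ t d) /=; ring.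
have -> : cint t (t + d) (fun v => c0 + c1 * (z + (s + d)%:C * a + v%:C * b) -
    (c0 + c1 * (z + s%:C * a + v%:C * b))) = d%:C * (c1 * d%:C * a).
  rewrite -[d in RHS](addrK t d) (addrC d) -cint_cst//.
  apply: eq_cint => v _; rewrite (rmorphD _ s d) /=; ring.
ring.
Qed.

Lemma pgram_int_le (h : C -> C) (z a b : C) (s t d K : R) : cts h ->
  0 < d -> (forall u v, s <= u <= s + d -> t <= v <= t + d ->
     nrm (h (z + u%:C * a + v%:C * b)) <= K) ->
  nrm (pgram_int h z a b s t d) <= 2 * (nrm a + nrm b) * K * d.
Proof.
move=> ch d0 HK; have [H1 H2] := continuous_pgram z a b ch.
have a0 := nrm_ge0 a; have b0 := nrm_ge0 b.
have dd x : x + d - x = d by rewrite addrC addKr.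
have xx x : x <= x <= x + d by rewrite lexx; lra.
have xd x : x <= x + d <= x + d by rewrite lexx andbT; lra.
have B (f : R -> C) x : cts f ->
    (forall t, x <= t <= x + d -> nrm (f t) <= K) ->
    nrm (cint x (x + d) f) <= K * d.
  by move=> cf /(cint_bound cf); rewrite dd; apply; lra.
have I1 := B _ s (H1 t) (fun u hu => HK u t hu (xx t)).
have I2 := B _ s (H1 (t + d)) (fun u hu => HK u (t + d) hu (xd t)).
have I3 := B _ t (H2 (s + d)) (fun v hv => HK (s + d) v (xd s) hv).
have I4 := B _ t (H2 s) (fun v hv => HK s v (xx s) hv).
rewrite pgram_intE//; move: I1 I2 I3 I4.
do 4 move: (cint _ _ _) => ?; move=> I1 I2 I3 I4.
apply: le_trans (nrmD _ _) _; rewrite !nrmM.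
apply: (@le_trans _ _ (nrm a * (K * d + K * d) + nrm b * (K * d + K * d))).
  by apply: lerD; apply: ler_wpM2l => //; apply: le_trans (nrmB _ _) _; lra.
by rewrite le_eqVlt; apply/orP; left; apply/eqP; ring.
Qed.

(** Subtracting the first-order Taylor polynomial at the point [w0] leaves the boundary integral
    unchanged and makes the integrand small compared with the diameter. *)
Lemma pgram_int_local (h : C -> C) (z a b : C) (s0 t0 e : R) :
  cts h -> (forall w, differentiable h w) -> 0 < e ->
  exists2 d0, 0 < d0 & forall s t d, 0 < d < d0 ->
    s <= s0 <= s + d -> t <= t0 <= t + d ->
    nrm (pgram_int h z a b s t d) <= e * d ^+ 2.
Proof.
move=> ch dh e0; pose w0 : C := z + s0%:C * a + t0%:C * b.
pose N := nrm a + nrm b + 1.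
have a0 := nrm_ge0 a; have b0 := nrm_ge0 b.
have N0 : 0 < N by rewrite /N; lra.
(* The remainder is at most [eta * (N * d)] and the perimeter at most [2 * N * d]; their product is
   [e * d ^+ 2]. The 1 added in [N] keeps it positive when both sides vanish. *)
pose eta := e / (2 * N ^+ 2).
have eta0 : 0 < eta by rewrite divr_gt0// mulr_gt0// exprn_gt0.
have [r r0 Hr] := diff_nrm (dh w0) eta0.
exists (r / N); first by rewrite divr_gt0.
move=> s t d /andP[d0]; rewrite ltr_pdivlMr// => dN /andP[s1 s2] /andP[t1 t2].
pose c1 : C := 'd h w0 1.
have c1E (k : C) : 'd h w0 k = c1 * k.
  by rewrite -{1}[k]mulr1 -[k * 1]/(k *: (1 : C)) linearZ /= mulrC.
pose c0 : C := h w0 - c1 * w0.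
pose g (w : C) : C := h w - (c0 + c1 * w).
have cA : cts (fun w : C => c0 + c1 * w : C).
  move=> w; apply/cont_nrmP => q q0.
  have n0 := nrm_ge0 c1.
  exists (q / (nrm c1 + 1)); first by rewrite divr_gt0//; lra.
  move=> y; rewrite ltr_pdivlMr; last lra.
  rewrite (_ : c0 + c1 * y - (c0 + c1 * w) = c1 * (y - w)); last by ring.
  by rewrite nrmM; have := nrm_ge0 (y - w); nra.
have cg : cts g := ctsB ch cA.
have -> : pgram_int h z a b s t d = pgram_int g z a b s t d.
  have cgA : cts (fun w => g w + (c0 + c1 * w)) := ctsD cg cA.
  have <- : (fun w => g w + (c0 + c1 * w)) = h.
    by apply/funext => w; rewrite subrK.
  rewrite -[RHS]addr0 -(pgram_int_affine z a b c0 c1 s t (ltW d0)).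
  exact (pgram_intD z a b s t d cg cA).
apply: le_trans (@pgram_int_le g z a b s t d (eta * (N * d)) cg d0 _) _.
  move=> u v /andP[u1 u2] /andP[v1 v2].
  pose k : C := (u - s0)%:C * a + (v - t0)%:C * b.
  have kN : nrm k <= N * d.
    apply: le_trans (nrmD _ _) _; rewrite !nrmM !nrmR.
    have : `|u - s0| <= d by rewrite ler_norml; lra.
    have : `|v - t0| <= d by rewrite ler_norml; lra.
    have := normr_ge0 (u - s0); have := normr_ge0 (v - t0).
    by rewrite /N; nra.
  have kr : nrm k < r by nra.
  have := Hr _ kr; rewrite c1E.
  have -> : z + u%:C * a + v%:C * b = w0 + k.
    by rewrite /w0 /k !rmorphB /=; ring.
  have -> : h (w0 + k) - h w0 - c1 * k = g (w0 + k) by rewrite /g /c0; ring.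
  by move/le_trans; apply; rewrite ler_pM2l.
have -> : e = eta * (2 * N ^+ 2) by rewrite /eta divfK// gt_eqF// mulr_gt0// exprn_gt0.
have : nrm a + nrm b <= N by rewrite /N; lra.
have E0 : 0 <= eta * N * d ^+ 2 by apply: mulr_ge0; [apply: mulr_ge0; exact: ltW|rewrite exprn_ge0 ?ltW].
have -> : 2 * (nrm a + nrm b) * (eta * (N * d)) * d =
  2 * (eta * N * d ^+ 2) * (nrm a + nrm b) by ring.
have -> : eta * (2 * N ^+ 2) * d ^+ 2 = 2 * (eta * N * d ^+ 2) * N by ring.
by move=> /ler_wpM2l; apply; rewrite mulr_ge0.
Qed.

Lemma nrm_sum4 (x1 x2 x3 x4 : C) (q : R) : nrm x1 <= q -> nrm x2 <= q ->
  nrm x3 <= q -> nrm x4 <= q -> nrm (x1 + x2 + x3 + x4) <= 4 * q.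
Proof.
move=> h1 h2 h3 h4; apply: le_trans (nrmD _ _) _.
apply: le_trans (lerD (nrmD _ _) (lexx _)) _.
apply: le_trans (lerD (lerD (nrmD _ _) (lexx _)) (lexx _)) _.
lra.
Qed.

Theorem goursat (h : C -> C) (z a b : C) :
  (forall w, differentiable h w) -> pgram_int h z a b 0 0 1 = 0.
Proof.
move=> dh; have ch : cts h by move=> w; exact: differentiable_continuous.
apply: nrm_eq0; apply/eqP; rewrite eq_le nrm_ge0 andbT.
apply/ler_addgt0Pr => e e0; rewrite add0r.
(* A bound proportional to the area is stable under quartering: the four bounds add up to the bound
   for the whole. *)
pose Q s t d := nrm (pgram_int h z a b s t d) <= e * d ^+ 2.
suff : Q 0 0 1 by rewrite /Q expr1n mulr1.
apply: (@square_bisection Q); last by move=> s t; exact: pgram_int_local.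
move=> s t d d0; rewrite /Q => Q1 Q2 Q3 Q4; rewrite pgram_int_split//.
have -> : e * d ^+ 2 = 4 * (e * (d / 2) ^+ 2) by field.
exact: nrm_sum4 Q1 Q2 Q3 Q4.
Qed.

Lemma periodic_mean (h : C -> C) (a b : C) : (forall w, differentiable h w) ->
  (forall w, h (w + b) = h w) -> b != 0 ->
  cint 0 1 (fun t => h (a + t%:C * b)) = cint 0 1 (fun t => h (t%:C * b)).
Proof.
move=> dh per b0; have ch : cts h.
  by move=> w; exact: differentiable_continuous.
have := goursat 0 a b dh; rewrite pgram_intE// !add0r.
(* The two sides parallel to [a] differ by the period and cancel; the other two are the means to be
   compared, multiplied by the nonzero [b]. *)
have -> : cint 0 1 (fun u => h (0 + u%:C * a + 1%:C * b)) =
    cint 0 1 (fun u => h (0 + u%:C * a + 0%:C * b)).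
  by apply: eq_cint => u _; rewrite mul1r per mul0r addr0.
have -> : cint 0 1 (fun v => h (1%:C * a + v%:C * b)) =
    cint 0 1 (fun v => h (a + v%:C * b)).
  by apply: eq_cint => v _; rewrite mul1r.
have -> : cint 0 1 (fun v => h (0%:C * a + v%:C * b)) =
    cint 0 1 (fun v => h (v%:C * b)).
  by apply: eq_cint => v _; rewrite mul0r add0r.
do ?[move: (cint _ _ _) => ?].
rewrite subrr mulr0 add0r => /eqP; rewrite mulf_eq0 (negPf b0) /= subr_eq0.
by move=> /eqP.
Qed.

End Goursat.

(** * The complex exponential *)

Section Exponential.
Variable R : realType.
Local Notation C := (R[i]^o : normedModType R[i]).

Lemma entire_cts (V W : normedModType R[i]) (h : V -> W) :
  (forall w, differentiable h w) -> cts h.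
Proof. by move=> dh w; exact: differentiable_continuous. Qed.

Lemma is_diff_complex (h : C -> C) (z d : C) :
  (forall e : R, 0 < e -> exists2 r : R, 0 < r &
    forall k, nrm k < r -> nrm (h (z + k) - h z - d * k) <= e * nrm k) ->
  is_diff z h ( *:%R d).
Proof.
move=> H; apply: (@is_diff_nrm _ C C h ( *:%R d) (nrm d)) => // k.
by rewrite nrmZ.
Qed.

Lemma is_derive_eps (f : R -> R) (a d : R) : is_derive a 1 f d ->
  forall e : R, 0 < e -> exists2 r : R, 0 < r &
    forall x, `|x| < r -> `|f (x + a) - f a - x * d| <= e * `|x|.
Proof.
move=> [/derivable_nbhsP + dE] e e0; rewrite dE => /eqaddoP/(_ _ e0).
move=> /nbhs_normP[r /= r0 Hr]; exists r => // x xr.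
have := Hr x; rewrite /= sub0r normrN => /(_ xr).
rewrite !fctE /= opprD addrA.
by rewrite -![_ *: _]/(_ * _) mulr1.
Qed.

Definition cexp (z : C) : C :=
  (expR (complex.Re z) * cos (complex.Im z)) +i*
  (expR (complex.Re z) * sin (complex.Im z)).

Definition twopii : C := 0 +i* (pi *+ 2).

Lemma cexpD (z w : C) : cexp (z + w) = cexp z * cexp w.
Proof.
case: z w => a b [c d]; apply/eqP; rewrite eq_complex /= expRD cosD sinD.
by apply/andP; split; apply/eqP; ring.
Qed.

Lemma cexp0 : cexp 0 = 1.
Proof. by apply/eqP; rewrite eq_complex /= expR0 cos0 sin0 mulr1 mulr0 !eqxx. Qed.

Lemma cexpN (z : C) : cexp (- z) * cexp z = 1.
Proof. by rewrite -cexpD addNr cexp0. Qed.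

Lemma cexp_neq0 (z : C) : cexp z != 0.
Proof.
apply/eqP => h; have := cexpN z; rewrite h mulr0 => /eqP.
by rewrite eq_sym oner_eq0.
Qed.

Lemma cexp_inv (z : C) : cexp (- z) = (cexp z)^-1.
Proof. by rewrite -[LHS]mulr1 -(divff (cexp_neq0 z)) mulrA cexpN mul1r. Qed.

Lemma nrm_cexp (z : C) : nrm (cexp z) = expR (complex.Re z).
Proof.
apply/eqP; rewrite -(eqrXn2 (n := 2))// ?nrm_ge0 ?expR_ge0// nrm_sq /=.
by rewrite !exprMn -mulrDr cos2Dsin2 mulr1.
Qed.

Lemma cexp_periodic (z : C) : cexp (z + twopii) = cexp z.
Proof.
by rewrite cexpD -[RHS]mulr1; congr (_ * _); apply/eqP;
  rewrite eq_complex /= expR0 cos2pi sin2pi mulr1 mulr0 !eqxx.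
Qed.

Lemma twopii_neq0 : twopii != 0.
Proof.
rewrite eq_complex /= eqxx /= mulrn_eq0 /=.
by rewrite gt_eqF// pi_gt0.
Qed.

Lemma cexp_near0 (e : R) : 0 < e -> exists2 r : R, 0 < r &
  forall k, nrm k < r -> nrm (cexp k - 1 - k) <= e * nrm k.
Proof.
(* The errors below are [3 + 1] times [q * N] in the real part and [3 + 2] times in the imaginary
   part, hence the 9. The cap at 1 gives [expR x <= 3]. *)
move=> e0; pose q := Num.min 1 (e / 9).
have q0 : 0 < q by rewrite lt_min ltr01 divr_gt0.
have q1 : q <= 1 by rewrite ge_min lexx.
have qe : 9 * q <= e by rewrite mulrC -ler_pdivlMr// ge_min lexx orbT.
clearbody q.
have [r1 r10 H1] := is_derive_eps (is_derive_expR (0 : R)) q0.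
have [r2 r20 H2] := is_derive_eps (is_derive_cos (0 : R)) q0.
have [r3 r30 H3] := is_derive_eps (is_derive_sin (0 : R)) q0.
exists (Num.min q (Num.min r1 (Num.min r2 r3))).
  by rewrite !lt_min q0 r10 r20 r30.
case=> x y; rewrite !lt_min => /and4P[kq k1 k2 k3].
set N := nrm _ in kq k1 k2 k3 *.
have xN : `|x| <= N := nrm_Re (x +i* y).
have yN : `|y| <= N := nrm_Im (x +i* y).
move: (H1 x (le_lt_trans xN k1)) (H2 y (le_lt_trans yN k2)) (H3 y (le_lt_trans yN k3)).
rewrite !addr0 expR0 cos0 sin0 oppr0 mulr0 !mulr1 !subr0 !addr0 {H1 H2 H3} => A1 A2 A3.
have E0 := expR_gt0 x.
have E3 : expR x <= 3.
  have := A1; rewrite ler_norml => /andP[_]; have := ler_norm x.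
  by have := normr_ge0 x; nra.
apply: le_trans (nrm_le_ReIm _) _ => /=.
have B1 : `|expR x * cos y - 1 - x| <= 3 * (q * N) + q * N.
  have -> : expR x * cos y - 1 - x = expR x * (cos y - 1) + (expR x - 1 - x) by ring.
  apply: le_trans (ler_normD _ _) _; rewrite normrM (gtr0_norm E0).
  have a2 : `|cos y - 1| <= q * N by apply: le_trans A2 _; rewrite ler_pM2l.
  have a1 : `|expR x - 1 - x| <= q * N by apply: le_trans A1 _; rewrite ler_pM2l.
  apply: lerD => //; apply: ler_pM => //; exact: ltW.
have B2 : `|expR x * sin y - y| <= 3 * (q * N) + 2 * (q * N).
  have -> : expR x * sin y - y = expR x * (sin y - y) + ((expR x - 1 - x) + x) * y.
    by ring.
  apply: le_trans (ler_normD _ _) _; rewrite !normrM (gtr0_norm E0).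
  have a2 : `|sin y - y| <= q * N by apply: le_trans A3 _; rewrite ler_pM2l.
  have a1 : `|expR x - 1 - x + x| <= 2 * q.
    apply: le_trans (ler_normD _ _) _; have := normr_ge0 x; nra.
  apply: lerD; first by apply: ler_pM => //; exact: ltW.
  by rewrite mulrA; apply: ler_pM.
have N0 : 0 <= N := nrm_ge0 _.
by rewrite oppr0 addr0; nra.
Qed.

Lemma cexp_is_diff (z : C) : is_diff z cexp ( *:%R (cexp z)).
Proof.
apply: is_diff_complex => e e0.
have E0 : 0 < nrm (cexp z) by rewrite nrm_cexp expR_gt0.
have [|r r0 Hr] := @cexp_near0 (e / nrm (cexp z)); first by rewrite divr_gt0.
exists r => // k /Hr; rewrite cexpD.
rewrite (_ : cexp z * cexp k - cexp z - cexp z * k = cexp z * (cexp k - 1 - k)).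
  by rewrite nrmM mulrAC ler_pdivlMr// mulrC.
by ring.
Qed.

Lemma cexp_entire (z : C) : differentiable cexp z.
Proof. by have [] := cexp_is_diff z. Qed.

Lemma cexp_surj (z : C) : z != 0 -> exists w, cexp w = z.
Proof.
move=> z0; have r0 : 0 < nrm z by exact: nrm_gt0.
case: z r0 {z0} => p q; set r := nrm _ => r0.
have pq : (p / r) ^+ 2 + (q / r) ^+ 2 = 1.
  have := nrm_sq (p +i* q); rewrite -/r /= => h.
  by rewrite !expr_div_n -mulrDl -h divff// expf_neq0// gt_eqF.
have p1 : -1 <= p / r <= 1.
  by move: pq; move: (p / r) (q / r) => u v; have := sqr_ge0 v; nra.
have sE : sin (acos (p / r)) = `|q / r|.
  by rewrite sin_acos// -pq addrAC subrr add0r sqrtr_sqr.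
have cE : cos (acos (p / r)) = p / r by rewrite acosK// in_itv.
have rp : r * (p / r) = p by rewrite mulrC divfK// gt_eqF.
have rq : r * (q / r) = q by rewrite mulrC divfK// gt_eqF.
(* [acos] yields an argument in [0, pi] only, so the sign of the imaginary part decides between it
   and its opposite. *)
have [q0|q0] := leP 0 (q / r).
  exists (ln r +i* acos (p / r)); apply/eqP; rewrite eq_complex /= lnK//.
  by rewrite cE sE ger0_norm// rp rq !eqxx.
exists (ln r +i* - acos (p / r)); apply/eqP; rewrite eq_complex /= lnK//.
by rewrite cosN sinN cE sE ltr0_norm// opprK rp rq !eqxx.
Qed.

End Exponential.

(** * Circle means and Cauchy's estimate *)

Section Cauchy.
Variable R : realType.
Local Notation C := (R[i]^o : normedModType R[i]).
Local Notation twopii := (twopii R).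

Definition mean (h : C -> C) : C := cint 0 1 (fun t => h (t%:C * twopii)).

Lemma cts_circle (h : C -> C) : cts h -> cts (fun t : R => h (t%:C * twopii)).
Proof.
move=> ch; have := @continuous_line _ h 0 twopii ch; congr cts.
by apply/funext => t; rewrite add0r.
Qed.

Lemma Re_circle (t : R) : complex.Re (t%:C * twopii) = 0.
Proof. by rewrite /= mulr0 mul0r subrr. Qed.

Lemma eq_mean (f g : C -> C) : f =1 g -> mean f = mean g.
Proof. by move=> fg; apply: eq_cint => t _; exact: fg. Qed.

Lemma meanD (f g : C -> C) : cts f -> cts g ->
  mean (fun w => f w + g w) = mean f + mean g.
Proof. by move=> cf cg; rewrite /mean (cintD 0 1 (cts_circle cf) (cts_circle cg)). Qed.

Lemma meanB (f g : C -> C) : cts f -> cts g ->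
  mean (fun w => f w - g w) = mean f - mean g.
Proof. by move=> cf cg; rewrite /mean (cintB 0 1 (cts_circle cf) (cts_circle cg)). Qed.

Lemma meanZ (c : C) (f : C -> C) : cts f -> mean (fun w => c * f w : C) = c * mean f.
Proof. by move=> cf; rewrite /mean (cintZ 0 1 c (cts_circle cf)). Qed.

Lemma mean_cst (c : C) : mean (fun=> c) = c.
Proof. by rewrite /mean cint_cst// subr0 mul1r. Qed.

Lemma mean_bound (f : C -> C) (K : R) : cts f ->
  (forall w, complex.Re w = 0 -> nrm (f w) <= K) -> nrm (mean f) <= K.
Proof.
move=> cf HK; rewrite -[K]mulr1 -[X in _ * X](subr0 1).
apply: (cint_bound (cts_circle cf)) => // t _; apply: HK; exact: Re_circle.
Qed.

Lemma mean_shift (h : C -> C) (a : C) : (forall w, differentiable h w) ->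
  (forall w, h (w + twopii) = h w) -> mean (fun w => h (a + w)) = mean h.
Proof. by move=> dh per; exact: (periodic_mean a dh per (twopii_neq0 R)). Qed.

Lemma cts_comp (T U W : topologicalType) (f : T -> U) (g : U -> W) : cts f -> cts g ->
  cts (fun x => g (f x)).
Proof. by move=> cf cg x; apply: (@continuous_comp _ _ _ f g); [exact: cf|exact: cg]. Qed.

(** In the variable [cexp w] the number [l] is the value at the puncture 0. The mean does not depend
    on the circle, so it may be taken on one so small that [h] is within [e] of [l] all along it. *)
Lemma mean_limit (h : C -> C) (l a : C) : (forall w, differentiable h w) ->
  (forall w, h (w + twopii) = h w) ->
  (forall e : R, 0 < e -> exists A : R, forall w,
     complex.Re w <= A -> nrm (h w - l) <= e) ->
  mean (fun w => h (a + w)) = l.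
Proof.
move=> dh per H; rewrite (mean_shift a dh per).
apply/eqP; rewrite -subr_eq0; apply/eqP/nrm_eq0/eqP.
rewrite eq_le nrm_ge0 andbT; apply/ler_addgt0Pr => e e0; rewrite add0r.
have [A HA] := H e e0; pose b : C := A%:C.
rewrite -(mean_shift b dh per) -(mean_cst l).
have cb : cts (fun w => h (b + w)).
  by apply: cts_comp (entire_cts dh); apply: entire_cts; exact: diff_add_cst.
have cl : cts (fun _ : C => l) := @cts_cst R[i] C C l.
rewrite -(meanB cb cl).
apply: (mean_bound (ctsB cb cl)) => w w0; apply: HA.
by rewrite /b; case: w w0 => p q /= ->; rewrite addr0.
Qed.

Lemma is_diff_line (V W : normedModType R[i]) (G : V -> W) (x v : V) (w : C) :
  differentiable G (x + w *: v) ->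
  is_diff w (fun t : C => G (x + t *: v)) (fun t : C => 'd G (x + w *: v) (t *: v)).
Proof.
move=> dG; have [dl el] := is_diff_affine x v w.
split; first exact: (differentiable_comp dl dG).
by rewrite (diff_comp dl dG) el.
Qed.

Lemma diff_comp_cexp (h : C -> C) (z w : C) : (forall w, differentiable h w) ->
  differentiable (fun w => h (z + cexp w)) w.
Proof.
move=> dh.
have de : differentiable (fun w : C => z + cexp w) w.
  exact: (diff_add (differentiable_cst z w) (cexp_entire w)).
exact: (differentiable_comp de (dh _)).
Qed.

Lemma diff_cexpN (w : C) : differentiable (fun w : C => cexp (- w)) w.
Proof.
have dN : differentiable (fun w : C => - w : C) w.
  exact: (diff_opp (diff_id w)).
exact: (differentiable_comp dN (cexp_entire _)).
Qed.

Lemma cexp_small (r : R) : 0 < r ->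
  exists A : R, forall w : C, complex.Re w <= A -> nrm (cexp w) < r.
Proof.
move=> r0; exists (ln r - 1) => w wA; rewrite nrm_cexp -[ltRHS]lnK// ltr_expR.
lra.
Qed.

(** The real part of [a] is the logarithm of the radius of the circle around [z]. *)
Lemma mean_value (h : C -> C) (z a : C) : (forall w, differentiable h w) ->
  mean (fun w => h (z + cexp (a + w))) = h z.
Proof.
move=> dh; apply: (@mean_limit (fun w => h (z + cexp w))).
- by move=> w; exact: diff_comp_cexp.
- by move=> w; rewrite cexp_periodic.
move=> e e0; have /cont_nrmP/(_ _ e0)[r r0 Hr] := entire_cts dh (x := z).
have [A HA] := cexp_small r0; exists A => w /HA wr.
by apply/ltW/Hr; rewrite addrC addKr.
Qed.

(** Cauchy's formula for the first derivative: the exponential factor is the reciprocal of the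
    increment, so the integrand is a difference quotient, and it tends to the derivative as the
    radius shrinks. *)
Lemma mean_derivative (h : C -> C) (z a : C) : (forall w, differentiable h w) ->
  mean (fun w => (h (z + cexp (a + w)) - h z) * cexp (- (a + w))) = 'd h z 1.
Proof.
move=> dh; apply: (@mean_limit (fun w => (h (z + cexp w) - h z) * cexp (- w))).
- move=> w; apply: diff_mul; last exact: diff_cexpN.
  exact: (diff_sub (diff_comp_cexp z w dh) (differentiable_cst (h z) w)).
- by move=> w; rewrite !cexp_inv !cexp_periodic.
move=> e e0; have [r r0 Hr] := diff_nrm (dh z) e0.
have [A HA] := cexp_small r0; exists A => w /HA /Hr.
have n0 : 0 < nrm (cexp w) by rewrite nrm_cexp expR_gt0.
have -> : 'd h z (cexp w) = cexp w * 'd h z 1.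
  by rewrite -[X in 'd h z X]mulr1 -[X in 'd h z X]/(cexp w *: (1 : C)) linearZ.
have -> : (h (z + cexp w) - h z) * cexp (- w) - 'd h z 1 =
    (h (z + cexp w) - h z - cexp w * 'd h z 1) * cexp (- w).
  rewrite [RHS]mulrBl; congr (_ - _).
  by rewrite [RHS]mulrC mulrA cexpN mul1r.
rewrite nrmM cexp_inv nrmV => H.
by rewrite ler_pdivrMr.
Qed.

Lemma cauchy_estimate (h : C -> C) (z : C) (r M : R) :
  (forall w, differentiable h w) -> 0 < r ->
  (forall k, nrm k = r -> nrm (h (z + k) - h z) <= M) ->
  nrm ('d h z 1) <= M / r.
Proof.
move=> dh r0 HM; rewrite -(mean_derivative z (ln r)%:C dh).
have eE w : complex.Re w = 0 -> nrm (cexp ((ln r)%:C + w)) = r.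
  by move=> w0; rewrite nrm_cexp; case: w w0 => p q /= ->; rewrite addr0 lnK.
apply: mean_bound.
  apply: (cts_comp (f := fun w : C => (ln r)%:C + w : C)
    (g := fun w => (h (z + cexp w) - h z) * cexp (- w))).
    by apply: entire_cts; exact: diff_add_cst.
  apply: entire_cts => w; apply: diff_mul; last exact: diff_cexpN.
  exact: (diff_sub (diff_comp_cexp z w dh) (differentiable_cst (h z) w)).
move=> w w0; rewrite nrmM cexp_inv nrmV (eE _ w0) ler_pM2r ?invr_gt0//.
by apply: HM; exact: eE.
Qed.

Lemma is_derive_of_eps (f : R -> R) (a d : R) :
  (forall e : R, 0 < e -> exists2 r : R, 0 < r &
    forall x, `|x| < r -> `|f (a + x) - f a - x * d| <= e * `|x|) ->
  is_derive a 1 f d.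
Proof.
move=> H.
have L : (fun h => h^-1 *: ((f \o shift a) (h *: 1) - f a)) @ 0^' --> d.
  apply/cvgrPdist_le => e e0; have [r r0 Hr] := H _ e0.
  apply/nbhs_normP; exists r => // x /=; rewrite sub0r normrN => xr x0.
  have /ler_pM2l <- : 0 < `|x| by rewrite normr_gt0.
  rewrite -normrM mulrBr /= -![_ *: _]/(_ * _) mulrA divff// mul1r mulr1.
  by rewrite distrC (addrC x a) (mulrC `|x|); exact: Hr.
by split; [apply/cvg_ex; exists d|exact: cvg_lim].
Qed.

Lemma Re_mulB (c a b d : C) (x : R) :
  complex.Re (c * a : C) - complex.Re (c * b : C) - x * complex.Re (c * d : C) =
  complex.Re (c * (a - b - x%:C * d) : C).
Proof. case: c a b d => [? ?] [? ?] [? ?] [? ?] /=; ring. Qed.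

(** The mean value theorem needs a real function, so it is applied to the real part of [h]
    multiplied by the conjugate of the increment [D]; the increment of that function is
    [nrm D ^+ 2]. *)
Lemma mean_value_ineq (h : C -> C) (K : R) : (forall w, differentiable h w) ->
  (forall s : R, 0 <= s <= 1 -> nrm ('d h (s%:C : C) 1) <= K) ->
  nrm (h 1 - h 0) <= K.
Proof.
move=> dh HK; set D := h 1 - h 0; pose c : C := D^*%C.
pose u (s : R) : R := complex.Re (c * h s%:C : C).
have du (s : R) : is_derive s 1 u (complex.Re (c * 'd h (s%:C : C) 1 : C)).
  apply: is_derive_of_eps => e e0.
  have c0 := nrm_ge0 c.
  have [|r r0 Hr] := diff_nrm (dh (s%:C : C)) (e := e / (nrm c + 1)).
    by rewrite divr_gt0//; lra.
  exists r => // x xr; have := Hr x%:C; rewrite nrmR => /(_ xr).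
  have -> : 'd h (s%:C : C) x%:C = x%:C * 'd h (s%:C : C) 1.
    by rewrite -[X in 'd h _ X]mulr1 -[X in 'd h _ X]/(x%:C *: (1 : C)) linearZ.
  rewrite mulrAC ler_pdivlMr; last lra.
  have -> : u (s + x) - u s - x * complex.Re (c * 'd h (s%:C : C) 1 : C) =
    complex.Re (c * (h (s%:C + x%:C) - h s%:C - x%:C * 'd h (s%:C : C) 1) : C).
    by rewrite /u rmorphD /=; exact: Re_mulB.
  move=> H; apply: le_trans (nrm_Re _) _; rewrite nrmM.
  by apply: le_trans H; rewrite mulrC ler_wpM2l ?nrm_ge0//; lra.
have cu : continuous u.
  move=> s; apply: differentiable_continuous; apply/derivable1_diffP.
  by have [] := du s.
have [|s sI E] := MVT_segment ler01 (fun x _ => du x).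
  exact: continuous_subspaceT.
have K0 : nrm D ^+ 2 <= nrm D * K.
  rewrite -Re_conjM.
  have -> : complex.Re ((D^*%C : C) * D : C) = u 1 - u 0.
    by rewrite /u -Re_sub -mulrBr.
  rewrite E subr0 mulr1; apply: le_trans (ler_norm _) _.
  apply: le_trans (nrm_Re _) _; rewrite nrmM nrm_conj.
  by apply: ler_wpM2l; [exact: nrm_ge0|apply: HK; rewrite in_itv/= in sI].
have [D0|D0] := leP (nrm D) 0; last by move: K0; rewrite expr2 ler_pM2l.
by apply: le_trans D0 _; apply: le_trans (nrm_ge0 _) (HK 0 _); rewrite lexx ler01.
Qed.

End Cauchy.

(** * Lipschitz and second-order estimates for entire functions *)

Section AbstractDerivatives.
Variable K : numFieldType.

Lemma diff_increment (V W : normedModType K) (f : V -> W) (k : V) :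
  (forall y, differentiable f y) ->
  (forall w, differentiable (fun w => f (k + w) - f w) w) /\
  forall v, 'd (fun w => f (k + w) - f w) 0 v = 'd f k v - 'd f 0 v.
Proof.
move=> df; have dk w := diff_translate (df (k + w)).
split=> [w|v]; first exact: diff_sub.
by rewrite (diff_subE v (dk 0) (df 0)) (diff_translateE v (df (k + 0))) addr0.
Qed.

Lemma diff_sub_linear (h : K^o -> K^o) (c : K^o) :
  (forall y, differentiable h y) ->
  (forall w, differentiable (fun w => h w - w * c : K^o) w) /\
  forall w, 'd (fun w => h w - w * c : K^o) w 1 = 'd h w 1 - c.
Proof.
move=> dh; have dl w : is_diff w (fun w : K^o => w * c : K^o) ( *:%R^~ c).
  exact: (is_diff_scalel w c).
split=> w; have [dlw elw] := dl w; first exact: diff_sub.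
by rewrite (diff_subE _ (dh w) dlw) elw scale1r.
Qed.

End AbstractDerivatives.

Section Estimates.
Variable R : realType.
Local Notation C := (R[i]^o : normedModType R[i]).

Lemma diff_scale1 (W : normedModType R[i]) (h : C -> W) (z v : C) :
  'd h z v = v *: 'd h z 1.
Proof. by rewrite -[X in 'd h z X]mulr1 -[X in 'd h z X]/(v *: (1 : C)) linearZ. Qed.

Lemma entire_line (V W : normedModType R[i]) (G : V -> W) (x v : V) :
  (forall y, differentiable G y) ->
  forall w, differentiable (fun t : C => G (x + t *: v)) w.
Proof. by move=> dG w; have [] := is_diff_line (dG (x + w *: v)). Qed.

Lemma diff_line (V W : normedModType R[i]) (G : V -> W) (x v : V) (w : C) :
  (forall y, differentiable G y) ->
  'd (fun t : C => G (x + t *: v)) w 1 = 'd G (x + w *: v) v.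
Proof.
by move=> dG; have [_ ->] := is_diff_line (dG (x + w *: v)); rewrite scale1r.
Qed.

Lemma mean_value_segment (h : C -> C) (z v : C) (K : R) :
  (forall w, differentiable h w) ->
  (forall s : R, 0 <= s <= 1 -> nrm ('d h (z + s%:C * v) 1) <= K) ->
  nrm (h (z + v) - h z) <= K * nrm v.
Proof.
move=> dh HK.
have := @mean_value_ineq _ (fun t => h (z + t *: v)) (K * nrm v) (entire_line z v dh).
rewrite scale1r scale0r addr0; apply => s s01.
rewrite (@diff_line C C h z v s%:C dh) diff_scale1 nrmZ mulrC.
by apply: ler_wpM2r; [exact: nrm_ge0|exact: HK].
Qed.

Section Disc.
Variables (h : C -> C) (M rho : R).
Hypothesis dh : forall w, differentiable h w.
Hypothesis rho0 : 0 < rho.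
Hypothesis HM : forall k, nrm k <= rho -> nrm (h k) <= M.

Lemma disc_deriv (k : C) : nrm k <= rho / 2 -> nrm ('d h k 1) <= 4 * M / rho.
Proof.
have r0 := rho0.
move=> kr; have -> : 4 * M / rho = (2 * M) / (rho / 2) by field; rewrite gt_eqF.
apply: cauchy_estimate => //; first by rewrite divr_gt0.
move=> l lr; apply: le_trans (nrmB _ _) _.
rewrite mulr_natl mulr2n; apply: lerD; apply: HM; last by lra.
by apply: le_trans (nrmD _ _) _; rewrite lr; lra.
Qed.

Lemma disc_M_ge0 : 0 <= M.
Proof. by apply: le_trans (nrm_ge0 (h 0)) (HM _); rewrite nrm0 ltW. Qed.

Lemma disc_lipschitz (k l : C) : nrm k <= rho / 2 -> nrm l <= rho / 2 ->
  nrm (h k - h l) <= 4 * M / rho * nrm (k - l).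
Proof.
have r0 := rho0.
move=> kr lr; have := @mean_value_segment h l (k - l) (4 * M / rho) dh.
rewrite (addrC l (k - l)) subrK; apply => s /andP[s0 s1]; apply: disc_deriv.
have -> : l + s%:C * (k - l) = (1 - s)%:C * l + s%:C * k.
  by rewrite rmorphB /=; ring.
apply: le_trans (nrmD _ _) _; rewrite !nrmM !nrmR !ger0_norm//; last lra.
by have := nrm_ge0 k; have := nrm_ge0 l; nra.
Qed.

(** No second derivative is formed: Cauchy's estimate on the circle of radius [rho / 4] is applied
    to the increment [h (k + w) - h w], which [disc_lipschitz] already bounds by a multiple of
    [nrm k]. *)
Lemma disc_deriv_lipschitz (k : C) : nrm k <= rho / 4 ->
  nrm ('d h k 1 - 'd h 0 1) <= 32 * M / rho ^+ 2 * nrm k.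
Proof.
have r0 := rho0.
move=> kr; pose g (w : C) : C := h (k + w) - h w.
have [dg gE] := diff_increment k dh.
have <- : 'd g 0 1 = 'd h k 1 - 'd h 0 1 := gE 1.
have -> : 32 * M / rho ^+ 2 * nrm k = (8 * M / rho * nrm k) / (rho / 4).
  by field; rewrite gt_eqF.
apply: cauchy_estimate => //; first by rewrite divr_gt0.
have lipk w : nrm w <= rho / 4 -> nrm (g w) <= 4 * M / rho * nrm k.
  move=> wr; have -> : nrm k = nrm (k + w - w) by rewrite addrK.
  by apply: disc_lipschitz; [apply: le_trans (nrmD _ _) _|]; lra.
move=> w wr; rewrite add0r; apply: le_trans (nrmB _ _) _.
have -> : 8 * M / rho * nrm k = 4 * M / rho * nrm k + 4 * M / rho * nrm k by ring.
by apply: lerD; apply: lipk; rewrite ?nrm0 ?wr//; lra.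
Qed.

(** The derivative of [h] minus its linear part is ['d h s 1 - 'd h 0 1], small by
    [disc_deriv_lipschitz]; the mean value inequality contributes the second factor [nrm k]. *)
Lemma disc_quadratic (k : C) : nrm k <= rho / 4 ->
  nrm (h k - h 0 - k * 'd h 0 1) <= 32 * M / rho ^+ 2 * nrm k ^+ 2.
Proof.
have r0 := rho0.
move=> kr; pose g (w : C) : C := h w - w * 'd h 0 1.
have [dg dgE] := diff_sub_linear ('d h 0 1) dh.
have -> : h k - h 0 - k * 'd h 0 1 = g (0 + k) - g 0.
  by rewrite /g add0r mul0r subr0 addrAC.
rewrite expr2 mulrA; apply: mean_value_segment => // s /andP[s0 s1].
have -> : 'd g (0 + s%:C * k : C) 1 = 'd h (s%:C * k : C) 1 - 'd h 0 1.
  by rewrite add0r; exact: dgE.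
have sk : nrm (s%:C * k : C) <= nrm k.
  rewrite nrmM nrmR ger0_norm//; have := nrm_ge0 k; nra.
apply: le_trans (disc_deriv_lipschitz _) _; first exact: le_trans sk kr.
have M0 : 0 <= 32 * M by rewrite mulr_ge0// disc_M_ge0.
have p0 : 0 <= rho ^+ 2 by rewrite exprn_ge0// ltW.
by rewrite ler_wpM2l// divr_ge0.
Qed.

End Disc.

Section Ball.
Variables (V : normedModType R[i]) (G : V -> C) (x : V) (M rho : R).
Hypothesis dG : forall y, differentiable G y.
Hypothesis rho0 : 0 < rho.
Hypothesis HM : forall y, nrm (y - x) <= rho -> nrm (G y) <= M.

Lemma ball_line (v : V) (t : C) : v != 0 -> nrm t <= rho / nrm v ->
  nrm (G (x + t *: v)) <= M.
Proof.
have r0 := rho0.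
move=> v0; rewrite ler_pdivlMr ?nrm_gt0// => tv; apply: HM.
by rewrite addrC addKr nrmZ.
Qed.

Lemma ball_diff_bound (v : V) : nrm ('d G x v) <= 4 * M / rho * nrm v.
Proof.
have r0 := rho0.
have [->|v0] := eqVneq v 0; first by rewrite linear0 !nrm0 mulr0.
have vp := nrm_gt0 v0.
have := disc_deriv (entire_line x v dG) (divr_gt0 rho0 vp)
  (fun t => ball_line (t := t) v0) (k := 0).
rewrite (diff_line _ _ _ dG) scale0r addr0 nrm0 => H; apply: le_trans (H _) _.
  by rewrite ltW// divr_gt0// divr_gt0.
by rewrite invf_div mulrA le_eqVlt mulrAC eqxx.
Qed.

(** On the complex line through [x] directed by [v] the disc has radius [rho / nrm v], and the
    one-variable estimate is used at parameter 1. The powers of [nrm v] come from this rescaling. *)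
Lemma ball_quadratic (v : V) : nrm v <= rho / 4 ->
  nrm (G (x + v) - G x - 'd G x v) <= 32 * M / rho ^+ 2 * nrm v ^+ 2.
Proof.
have r0 := rho0.
have [-> _|v0 vr] := eqVneq v 0.
  by rewrite addr0 linear0 subr0 subrr !nrm0 expr0n mulr0.
have vp := nrm_gt0 v0.
have := disc_quadratic (entire_line x v dG) (divr_gt0 rho0 vp)
  (fun t => ball_line (t := t) v0) (k := 1).
rewrite (diff_line _ _ _ dG) scale0r scale1r addr0 mul1r nrm1 expr1n mulr1.
move=> H; apply: le_trans (H _) _.
  by rewrite mulrAC ler_pdivlMr// mul1r.
by rewrite expr_div_n invf_div mulrA mulrAC.
Qed.

(** The line starts at [y'], off centre, so only a disc of radius [(rho / 2) / nrm v] is used; since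
    [nrm v <= rho / 4], the parameter 1 that gives [y] lies in its inner half. *)
Lemma ball_lipschitz (y y' : V) : nrm (y - x) <= rho / 8 -> nrm (y' - x) <= rho / 8 ->
  nrm (G y - G y') <= 8 * M / rho * nrm (y - y').
Proof.
have r0 := rho0.
move=> hy hy'; have [->|/eqP yy] := eqVneq y y'.
  by rewrite !subrr !nrm0 mulr0.
have v0 : y - y' != 0 by rewrite subr_eq0; apply/eqP.
have vp := nrm_gt0 v0; set v := y - y' in v0 vp *.
have vr : nrm v <= rho / 4.
  by apply: le_trans (nrm_tri x y y') _; rewrite (nrm_distC x y'); lra.
have bl (t : C) : nrm t <= (rho / 2) / nrm v -> nrm (G (y' + t *: v)) <= M.
  rewrite ler_pdivlMr// => tv; apply: HM.
  rewrite addrAC; apply: le_trans (nrmD _ _) _; rewrite nrmZ; lra.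
have r2 : 0 < (rho / 2) / nrm v by rewrite divr_gt0// divr_gt0.
have := disc_lipschitz (entire_line y' v dG) r2 bl (k := 1) (l := 0).
rewrite scale1r scale0r addr0 subr0 nrm0 nrm1 mulr1 (addrC y' v) subrK => H.
apply: le_trans (H _ _) _; last 1 first.
- rewrite le_eqVlt; apply/orP; left; apply/eqP; field.
  by rewrite !gt_eqF.
- rewrite ler_pdivlMr// mul1r ler_pdivlMr//; lra.
- by rewrite ltW// divr_gt0.
Qed.

End Ball.

End Estimates.

(** * Holomorphy of parametrised circle means *)

Section Parametric.
Variable R : realType.
Local Notation C := (R[i]^o : normedModType R[i]).
Local Notation twopii := (twopii R).
Variables (V : normedModType R[i]) (g : (C * V)%type -> C).
Hypothesis cg : cts g.
Hypothesis dg : forall w y, differentiable (fun y => g (w, y)) y.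

Lemma param_near (w : C) (x : V) (e : R) : 0 < e -> exists2 d : R, 0 < d &
  forall w' y, nrm (w' - w) < d -> nrm (y - x) < d -> nrm (g (w', y) - g (w, x)) < e.
Proof.
move=> e0; have /cont_nrmP/(_ _ e0)[d d0 Hd] := cg (x := (w, x)).
exists d => // w' y h1 h2; apply: Hd; rewrite nrm_pair_lt.
by apply/andP; split; [exact: h1|exact: h2].
Qed.

Lemma cts_param (x : V) : cts (fun w => g (w, x)).
Proof.
move=> w; apply/cont_nrmP => e e0; have [d d0 Hd] := param_near w x e0.
by exists d => // y yd; apply: Hd => //; rewrite subrr nrm0.
Qed.

Lemma param_bound (w : C) (x : V) : exists d M : R, [/\ 0 < d, 0 <= M &
  forall w' y, nrm (w' - w) < d -> nrm (y - x) <= d -> nrm (g (w', y)) <= M].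
Proof.
have [d d0 Hd] := param_near w x ltr01.
exists (d / 2), (1 + nrm (g (w, x))); split; first by rewrite divr_gt0.
  by rewrite addr_ge0// nrm_ge0.
move=> w' y h1 h2; rewrite -[g (w', y)](subrK (g (w, x))).
apply: le_trans (nrmD _ _) _; rewrite lerD2r ltW// Hd//; lra.
Qed.

(** Two derivatives are compared through difference quotients with a common step [s]; the four
    errors total less than three quarters of [s * e]. *)
Lemma diff_quot_close (s e : R) (a1 a0 b1 b0 l l0 : C) : 0 < s -> 0 < e ->
  nrm (a1 - a0) < s * e / 8 -> nrm (b1 - b0) < s * e / 8 ->
  nrm (a1 - b1 - s%:C * l) <= s * (e / 4) ->
  nrm (a0 - b0 - s%:C * l0) <= s * (e / 4) -> nrm (l - l0) < e.
Proof.
move=> s0 e0 A1 A2 Q1 Q0.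
rewrite -(ltr_pM2l s0) -{1}(gtr0_norm s0) -nrmR -nrmM.
have -> : s%:C * (l - l0) = (a1 - a0) - (b1 - b0) -
    (a1 - b1 - s%:C * l) + (a0 - b0 - s%:C * l0) by ring.
apply: le_lt_trans (nrmD _ _) _.
apply: le_lt_trans (lerD (nrmB _ _) (lexx _)) _.
apply: le_lt_trans (lerD (lerD (nrmB _ _) (lexx _)) (lexx _)) _.
have : s * (e / 4) = s * e / 4 by rewrite mulrA.
have := mulr_gt0 s0 e0; move: Q1 Q0 A1 A2; lra.
Qed.

Lemma cts_param_diff (x v : V) : cts (fun w => 'd (fun y => g (w, y)) x v).
Proof.
move=> w; apply/cont_nrmP => e e0.
have [d [M [d0 M0 HM]]] := param_bound w x.
pose K := 32 * M / d ^+ 2.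
have K0 : 0 <= K by rewrite divr_ge0 ?sqr_ge0 ?mulr_ge0.
pose N := nrm v + 1; have N1 : 1 <= N by rewrite lerDr nrm_ge0.
have vN : nrm v <= N by rewrite lerDl.
have N0 : 0 < N by lra.
(* The first bound brings [s *: v] within reach of [ball_quadratic]; the second makes its remainder
   at most [s * (e / 4)]. The step stays fixed while [w'] tends to [w]. *)
pose s := Num.min (d / (4 * N)) (e / (4 * ((K + 1) * N ^+ 2))).
have KN : 0 < (K + 1) * N ^+ 2 by rewrite mulr_gt0 ?exprn_gt0//; lra.
have s0 : 0 < s by rewrite lt_min !divr_gt0// mulr_gt0.
have sd : s * N <= d / 4.
  apply: (@le_trans _ _ (d / (4 * N) * N)); first by rewrite ler_pM2r// ge_min lexx.
  by rewrite le_eqVlt; apply/orP; left; apply/eqP; field; rewrite gt_eqF.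
have se : s * ((K + 1) * N ^+ 2) <= e / 4.
  apply: (@le_trans _ _ (e / (4 * ((K + 1) * N ^+ 2)) * ((K + 1) * N ^+ 2))).
    by rewrite ler_pM2r// ge_min lexx orbT.
  move: KN; move: ((K + 1) * N ^+ 2) => q q0.
  by rewrite le_eqVlt; apply/orP; left; apply/eqP; field; rewrite gt_eqF.
clearbody s.
have quad w' : nrm (w' - w) < d ->
    nrm (g (w', x + s%:C *: v) - g (w', x) - s%:C * 'd (fun y => g (w', y)) x v)
      <= s * (e / 4).
  move=> w'd.
  have := @ball_quadratic _ _ (fun y => g (w', y)) x M d (dg w') d0
    (fun y => HM w' y w'd) (s%:C *: v).
  rewrite linearZ /= nrmZ nrmR gtr0_norm// -/K => H.
  apply: le_trans (H _) _; first by apply: le_trans sd; rewrite ler_pM2l.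
  have -> : K * (s * nrm v) ^+ 2 = s * (s * (K * nrm v ^+ 2)) by ring.
  rewrite ler_pM2l//; apply: le_trans se; rewrite ler_pM2l//.
  have : nrm v ^+ 2 <= N ^+ 2 by rewrite lerXn2r// nnegrE ?nrm_ge0// ltW.
  by have := sqr_ge0 (nrm v); move: (nrm v ^+ 2) (N ^+ 2) => p q; nra.
have se8 : 0 < s * e / 8 by rewrite divr_gt0// mulr_gt0.
have [d1 d10 H1] := param_near w (x + s%:C *: v) se8.
have [d2 d20 H2] := param_near w x se8.
exists (Num.min d (Num.min d1 d2)); first by rewrite !lt_min d0 d10.
move=> w'; rewrite !lt_min => /and3P[wd wd1 wd2].
have ww : nrm (w - w) < d by rewrite subrr nrm0.
have zz (y : V) (r : R) : 0 < r -> nrm (y - y) < r by rewrite subrr nrm0.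
exact (diff_quot_close s0 e0 (H1 w' _ wd1 (zz _ _ d10)) (H2 w' _ wd2 (zz _ _ d20))
  (quad w' wd) (quad w ww)).
Qed.

Lemma circle_bound (x : V) : exists d M : R, [/\ 0 < d, 0 <= M &
  forall t y, 0 <= t <= 1 -> nrm (y - x) <= d -> nrm (g (t%:C * twopii, y)) <= M].
Proof.
(* One integer encodes both the radius and the bound: larger [k] weakens [P], so compactness of the
   segment gives a common [k]. *)
pose P (k : nat) (t : R) := forall y, nrm (y - x) <= k.+1%:R^-1 ->
  nrm (g (t%:C * twopii, y)) <= k%:R.
have loc (t : R) : `[0, 1]%classic t -> \forall t' \near t & k \near \oo, P k t'.
  move=> _; have [d [M [d0 M0 HM]]] := param_bound (t%:C * twopii) x.
  have n0 := nrm_ge0 twopii.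
  exists ([set s : R | `|s - t| < d / (nrm twopii + 1)],
          [set k : nat | k.+1%:R^-1 < d /\ M <= k%:R]).
    split => /=.
      apply/nbhs_normP; exists (d / (nrm twopii + 1)).
        by rewrite /= divr_gt0//; lra.
      by move=> s /=; rewrite distrC.
    near=> k; split; first by near: k; exact: near_infty_natSinv_lt (PosNum d0).
    by near: k; exact: nbhs_infty_ger.
  case=> s k /= [sd [kd Mk]] y yk; apply: le_trans Mk; apply: HM; last first.
    exact: le_trans yk (ltW kd).
  have -> : s%:C * twopii - t%:C * twopii = (s - t)%:C * twopii :> C.
    by rewrite rmorphB mulrBl.
  rewrite nrmM nrmR; move: sd; rewrite ltr_pdivlMr; last lra.
  by have := normr_ge0 (s - t); nra.
have /compact_near_coveringP/(_ nat \oo P _ loc)[k _ /(_ k (leqnn k)) Hk] :=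
  @segment_compact R 0 1.
exists k.+1%:R^-1, k%:R; split => //.
by move=> t y t01 yk; apply: Hk => //; rewrite /= in_itv.
Unshelve. all: end_near. Qed.

Theorem mean_holomorphic (x : V) :
  differentiable (fun y => mean (fun w => g (w, y))) x /\
  forall v, 'd (fun y => mean (fun w => g (w, y))) x v =
    mean (fun w => 'd (fun y => g (w, y)) x v).
Proof.
pose L (v : V) : C := mean (fun w => 'd (fun y => g (w, y)) x v).
have cL v := @cts_param_diff x v.
have Llin : linear L.
  move=> a u v; change (L (a *: u + v) = a * L u + L v).
  rewrite /L -(meanZ a (cL u)).
  rewrite -(meanD (ctsM (@cts_cst R[i] C C a) (cL u)) (cL v)).
  by apply: eq_mean => w; rewrite linearP.
pose L' : {linear V -> C} := HB.pack L (GRing.isLinear.Build _ _ _ _ L Llin).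
have [d [M [d0 M0 HM]]] := circle_bound x.
pose K := 32 * M / d ^+ 2.
have K0 : 0 <= K by rewrite divr_ge0 ?sqr_ge0 ?mulr_ge0.
have D : is_diff x (fun y => mean (fun w => g (w, y))) L'.
  apply: (@is_diff_nrm _ _ _ _ _ (4 * M / d)) => [v|e e0].
    rewrite /= /L -[leRHS]mulr1 -[X in _ * X](subr0 1).
    apply: (cint_bound (cts_circle (cL v))) => // t t01.
    exact: (@ball_diff_bound _ _ (fun y => g (_, y)) x M d (dg _) d0
      (fun y => HM t y t01)).
  exists (Num.min (d / 4) (e / (K + 1))).
    by rewrite lt_min !divr_gt0//; lra.
  move=> v; rewrite lt_min => /andP[v1 v2].
  have cv := @cts_param (x + v); have cx := @cts_param x.
  rewrite /= /L -(meanB cv cx) -(meanB (ctsB cv cx) (cL v)).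
  rewrite -[leRHS]mulr1 -[X in _ * X](subr0 1).
  apply: (cint_bound (cts_circle (ctsB (ctsB cv cx) (cL v)))) => // t t01.
  apply: le_trans (@ball_quadratic _ _ (fun y => g (_, y)) x M d (dg _) d0
      (fun y => HM t y t01) v (ltW v1)) _.
  rewrite -/K expr2 mulrA ler_wpM2r ?nrm_ge0//.
  move: v2; rewrite ltr_pdivlMr; last lra.
  by have := nrm_ge0 v; nra.
case: D => D1 D2; split; first exact D1.
by move=> v; exact (congr1 (fun l => l v) D2).
Qed.

End Parametric.

(** * The maximum principle on a strip *)

Section MaximumPrinciple.
Variable R : realType.
Local Notation C := (R[i]^o : normedModType R[i]).
Local Notation twopii := (twopii R).

Lemma Re_mean_le (f : C -> C) (B : R) : cts f ->
  (forall w, complex.Re w = 0 -> complex.Re (f w) <= B) -> complex.Re (mean f) <= B.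
Proof.
move=> cf HB; rewrite /mean /cint /= -[B]mulr1 -[X in _ * X](subr0 1) -rint_cst//.
apply: le_rint => [|t|t _]; first exact (continuous_Re (cts_circle cf)).
  exact: cvg_cst.
by apply: HB; exact: Re_circle.
Qed.

Lemma mean_value_Re (h : C -> C) (r B : R) : (forall w, differentiable h w) -> 0 < r ->
  (forall k, nrm k = r -> complex.Re (h k) <= B) -> complex.Re (h 0) <= B.
Proof.
move=> dh r0 HB; rewrite -(mean_value 0 (ln r)%:C dh); apply: Re_mean_le.
  apply: (cts_comp (f := fun w : C => (ln r)%:C + w : C) (g := fun w => h (0 + cexp w))).
    by apply: entire_cts; exact: diff_add_cst.
  by apply: entire_cts => w; exact: diff_comp_cexp.
move=> w w0; rewrite add0r; apply: HB.
by rewrite nrm_cexp; case: w w0 => p q /= ->; rewrite addr0 lnK.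
Qed.

Lemma cts_real_complex : cts (fun r : R => r%:C : C).
Proof.
move=> r; apply/contR_nrmP => e e0; exists e => // s.
by rewrite -rmorphB nrmR.
Qed.

Lemma cts_complex_of_pair : cts (fun p : R * R => p.1 +i* p.2 : C).
Proof.
have c1 : cts (fun p : R * R => p.1%:C : C).
  by apply: (cts_comp _ cts_real_complex) => p; exact: cvg_fst.
have c2 : cts (fun p : R * R => p.2%:C : C).
  by apply: (cts_comp _ cts_real_complex) => p; exact: cvg_snd.
have := ctsD c1 (ctsM (@cts_cst R[i] _ C 'i) c2).
by congr cts; apply/funext => -[a b] /=; rewrite [RHS]complexE.
Qed.

Lemma cts_Re_comp (h : C -> C) : cts h -> cts (fun w => complex.Re (h w)).
Proof.
move=> ch w; apply/cont_realP => e e0; have /cont_nrmP/(_ _ e0)[d d0 Hd] := ch w.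
exists d => // y /Hd; apply: le_lt_trans; rewrite -Re_sub; exact: nrm_Re.
Qed.

(** Adding [e * Re w ^+ 2] makes the real part strictly subharmonic. Periodicity reduces the strip
    to a compact rectangle, where a maximum exists; it is not on the sides of the strip, and
    strictness excludes an interior one. A real [w0] lies in the rectangle; [strip_max_Re] reaches
    the rest by vertical translation. *)
Lemma strip_max_Re_real (k : C -> C) (s1 s2 B : R) :
  (forall w, differentiable k w) -> (forall w, k (w + twopii) = k w) ->
  (forall w, complex.Re w = s1 -> complex.Re (k w) <= B) ->
  (forall w, complex.Re w = s2 -> complex.Re (k w) <= B) ->
  forall w, complex.Im w = 0 -> s1 <= complex.Re w <= s2 -> complex.Re (k w) <= B.
Proof.
move=> dk per B1 B2 w0 w0im /andP[w1 w2]; rewrite leNgt; apply/negP => Bw.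
pose S := s1 ^+ 2 + s2 ^+ 2 + 1.
have sq1 := sqr_ge0 s1; have sq2 := sqr_ge0 s2.
have S0 : 0 < S by rewrite /S; lra.
(* [S] exceeds both [s1 ^+ 2] and [s2 ^+ 2], so on the sides of the strip the added term is less
   than the excess of [k w0] over [B]. *)
pose e := (complex.Re (k w0) - B) / (2 * S).
have e0 : 0 < e by rewrite divr_gt0 ?mulr_gt0// subr_gt0.
have eS : e * S < complex.Re (k w0) - B.
  have -> : e * S = (complex.Re (k w0) - B) / 2 by rewrite /e; field; rewrite gt_eqF.
  by rewrite ltr_pdivrMr// ltr_pMr// ?subr_gt0//; lra.
clearbody e.
have pi0 : 0 < pi *+ 2 :> R by rewrite mulrn_wgt0// pi_gt0.
pose u (w : C) : R := complex.Re (k w) + e * complex.Re w ^+ 2.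
have uper w : u (w + twopii) = u w.
  by rewrite /u per; case: w => a b /=; rewrite addr0.
have uperN w : u (w - twopii) = u w by rewrite -uper subrK.
have cu : continuous (fun p : R * R => u (p.1 +i* p.2)).
  have c1 : cts (fun p : R * R => complex.Re (k (p.1 +i* p.2))).
    exact: (cts_comp cts_complex_of_pair (cts_Re_comp (entire_cts dk))).
  move=> p; apply: cvgD; first exact: c1.
  by apply: cvgM; [exact: cvg_cst|apply: cvgM; exact: cvg_fst].
pose A : set (R * R) := `[s1, s2] `*` `[0, pi *+ 2].
have cA : compact A by apply: compact_setX; exact: segment_compact.
have A0 : A !=set0.
  by exists (s1, 0); split; rewrite /= in_itv/= lexx /=; [lra|exact: ltW].
have [[a b]] := compact_EVT_max A0 cA (continuous_subspaceT cu).
rewrite inE => -[/=]; rewrite !in_itv/= => /andP[a1 a2] /andP[b1 b2] umax.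
(* One more period on either side leaves room for a disc around a maximum lying on the horizontal
   edge of the rectangle. *)
have umax' (w : C) : s1 <= complex.Re w <= s2 -> - (pi *+ 2) <= complex.Im w <= 2 * (pi *+ 2) ->
    u w <= u (a +i* b).
  have inA x y : s1 <= x <= s2 -> 0 <= y <= pi *+ 2 -> u (x +i* y) <= u (a +i* b).
    by move=> hx hy; apply: (umax (x, y)); rewrite inE; split; rewrite /= in_itv.
  case: w => x y /= hx /andP[y1 y2].
  have [y0|y0] := ltP y 0.
    rewrite -uper; have -> : (x +i* y : C) + twopii = x +i* (y + pi *+ 2).
      by apply/eqP; rewrite eq_complex /= addr0 !eqxx.
    by apply: inA => //; apply/andP; split; lra.
  have [y3|y3] := leP y (pi *+ 2); first by apply: inA => //; rewrite y0.
  rewrite -uperN; have -> : (x +i* y : C) - twopii = x +i* (y - pi *+ 2).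
    by apply/eqP; rewrite eq_complex /= subr0 !eqxx.
  by apply: inA => //; apply/andP; split; lra.
pose ws : C := a +i* b.
have uw0 : complex.Re (k w0) <= u ws.
  apply: le_trans (umax' w0 _ _); rewrite ?w1 ?w0im//; last lra.
  by rewrite /u lerDl mulr_ge0 ?sqr_ge0// ltW.
have na x : (forall w, complex.Re w = x -> complex.Re (k w) <= B) -> x ^+ 2 <= S -> a <> x.
  move=> Bx xS ax; have := Bx ws ax; move: uw0; rewrite /u /ws /= ax => U.
  by have := ler_wpM2l (ltW e0) xS; lra.
have a1' : s1 < a.
  rewrite lt_neqAle a1 andbT; apply/eqP => /esym; apply: na B1 _; rewrite /S; lra.
have a2' : a < s2.
  rewrite lt_neqAle a2 andbT; apply/eqP; apply: na B2 _; rewrite /S; lra.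
pose r := Num.min (a - s1) (Num.min (s2 - a) (pi *+ 2)).
have r0 : 0 < r by rewrite !lt_min pi0 !subr_gt0 a1' a2'.
have [r1 r2 r3] : [/\ r <= a - s1, r <= s2 - a & r <= pi *+ 2].
  by rewrite !ge_min !lexx !orbT.
clearbody r.
(* The real part of [p t] is [u (ws + t) - e * a ^+ 2 - e / 2 * nrm t ^+ 2]: on the circle of radius
   [r] it stays strictly below its value at the centre, against the mean value property. *)
pose p (t : C) : C := k (ws + t) + ((2 * e * a)%:C * t + (e / 2)%:C * (t * t)).
have dp t : differentiable p t.
  apply: diff_add; first exact: diff_translate.
  have dc (c : C) : differentiable (fun _ : C => c) t by exact: differentiable_cst.
  apply: diff_add; apply: diff_mul; do ?exact: dc; do ?exact: diff_id.
  by apply: diff_mul; exact: diff_id.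
have p0 : p 0 = k ws by rewrite /p addr0 !mulr0 !addr0.
have ReD (z z' : C) : complex.Re (z + z') = complex.Re z + complex.Re z'.
  by case: z z' => ? ? [].
have ImD (z z' : C) : complex.Im (z + z') = complex.Im z + complex.Im z'.
  by case: z z' => ? ? [].
have : complex.Re (p 0) <= complex.Re (k ws) - e * r ^+ 2 / 2.
  apply: (mean_value_Re dp r0) => t tr.
  have tR : `|complex.Re t| <= r by rewrite -tr nrm_Re.
  have tI : `|complex.Im t| <= r by rewrite -tr nrm_Im.
  have tq : r ^+ 2 = complex.Re t ^+ 2 + complex.Im t ^+ 2 by rewrite -tr nrm_sq.
  have : u (ws + t) <= u ws.
    move: tR tI; rewrite !ler_norml => /andP[? ?] /andP[? ?].
    by apply: umax'; rewrite ?ReD ?ImD /=; apply/andP; split; lra.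
  rewrite /u /p !ReD tq; move: (complex.Re (k (ws + t))) (complex.Re (k ws)) => ? ?.
  by case: (t) => x y /=; lra.
rewrite p0; have : 0 < e * r ^+ 2 by rewrite mulr_gt0// exprn_gt0.
lra.
Qed.

Lemma strip_max_Re (k : C -> C) (s1 s2 B : R) :
  (forall w, differentiable k w) -> (forall w, k (w + twopii) = k w) ->
  (forall w, complex.Re w = s1 -> complex.Re (k w) <= B) ->
  (forall w, complex.Re w = s2 -> complex.Re (k w) <= B) ->
  forall w, s1 <= complex.Re w <= s2 -> complex.Re (k w) <= B.
Proof.
move=> dk per B1 B2 [x y] /= xs; pose v : C := 0 +i* y.
have := @strip_max_Re_real (fun w => k (v + w)) s1 s2 B _ _ _ _ x%:C erefl xs.
have -> : v + x%:C = x +i* y by apply/eqP; rewrite eq_complex /= add0r addr0 !eqxx.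
apply.
- by move=> w; exact: diff_translate.
- by move=> w; rewrite addrA per.
- by case=> a b /= ab; apply: B1; rewrite /= add0r.
- by case=> a b /= ab; apply: B2; rewrite /= add0r.
Qed.

(** The case of real parts, applied to [h] multiplied by the conjugate of its value at the point
    considered. *)
Lemma strip_max (h : C -> C) (s1 s2 K : R) :
  (forall w, differentiable h w) -> (forall w, h (w + twopii) = h w) ->
  (forall w, complex.Re w = s1 -> nrm (h w) <= K) ->
  (forall w, complex.Re w = s2 -> nrm (h w) <= K) ->
  forall w, s1 <= complex.Re w <= s2 -> nrm (h w) <= K.
Proof.
move=> dh per K1 K2 w ws; pose c : C := (h w)^*%C.
have [h0|h0] := leP (nrm (h w)) 0.
  by apply: le_trans h0 (le_trans (nrm_ge0 _) (K1 s1%:C _)).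
rewrite -(ler_pM2l h0) -expr2 -Re_conjM.
have cK v : nrm (h v) <= K -> complex.Re (c * h v : C) <= nrm (h w) * K.
  move=> hK; apply: le_trans (ler_norm _) _; apply: le_trans (nrm_Re _) _.
  by rewrite nrmM nrm_conj ler_wpM2l// nrm_ge0.
apply: (@strip_max_Re (fun w => c * h w) s1 s2) => //.
- move=> v; apply: diff_mul; [exact: differentiable_cst|exact: dh].
- by move=> v; rewrite per.
- by move=> v /K1 /cK.
- by move=> v /K2 /cK.
Qed.

End MaximumPrinciple.

(** * The action in logarithmic time and its linearization *)

Section AbstractMaps.
Variable K : numFieldType.

Lemma diff_fst (V W : normedModType K) (q : V * W) :
  differentiable (fun q : V * W => q.1) q.
Proof.
pose f : {linear (V * W)%type -> V} := fst.
by apply: (@linear_differentiable _ _ _ f) => r; exact: cvg_fst.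
Qed.

Lemma diff_snd (V W : normedModType K) (q : V * W) :
  differentiable (fun q : V * W => q.2) q.
Proof.
pose f : {linear (V * W)%type -> W} := snd.
by apply: (@linear_differentiable _ _ _ f) => r; exact: cvg_snd.
Qed.

Lemma diff_pairf (U V W : normedModType K) (f : U -> V) (g : U -> W) x :
  differentiable f x -> differentiable g x ->
  differentiable (fun y => (f y, g y)) x.
Proof. by move=> df dg; exact: differentiable_pair. Qed.

Lemma diff_compf (U V W : normedModType K) (f : U -> V) (g : V -> W) x :
  differentiable f x -> differentiable g (f x) ->
  differentiable (fun y => g (f y)) x.
Proof. by move=> df dg; exact: (differentiable_comp df dg). Qed.

Lemma diff_compfE (U V W : normedModType K) (f : U -> V) (g : V -> W) x v :
  differentiable f x -> differentiable g (f x) ->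
  'd (fun y => g (f y)) x v = 'd g (f x) ('d f x v).
Proof. by move=> df dg; have /= -> := congr1 (@^~ v) (diff_comp df dg). Qed.

Lemma coord_linear_continuous n (j : 'I_n) :
  continuous (fun y : 'rV[K]_n => y ord0 j : K^o).
Proof. by move=> y; exact: coord_continuous. Qed.

Lemma diff_coordE (V : normedModType K) n (F : V -> 'rV[K]_n) (x v : V) j :
  differentiable F x ->
  'd (fun y => F y ord0 j : K^o) x v = ('d F x v) ord0 j.
Proof.
move=> dF; rewrite (@diff_compfE _ _ _ F (fun y : 'rV[K]_n => y ord0 j : K^o))//.
  have Llin : linear (fun y : 'rV[K]_n => y ord0 j : K^o) by move=> a y z; rewrite !mxE.
  pose L : {linear 'rV[K]_n -> K^o} := HB.pack (fun y : 'rV[K]_n => y ord0 j : K^o)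
    (GRing.isLinear.Build _ _ _ _ (fun y : 'rV[K]_n => y ord0 j : K^o) Llin).
  by rewrite (@diff_lin _ _ _ L (F x) (@coord_linear_continuous n j)).
exact: diff_coord.
Qed.

Lemma diff_row (V : normedModType K) n (f : 'I_n -> V -> K^o) (x : V) :
  (forall j, differentiable (f j) x) ->
  differentiable (fun y => \row_j f j y : 'rV[K]_n) x.
Proof.
move=> df.
rewrite (_ : (fun y => _) = (fun y => \sum_j f j y *: (delta_mx ord0 j : 'rV[K]_n))).
  by apply: diff_sum => j; exact: differentiableZl.
apply/funext => y; rewrite [LHS]row_sum_delta.
by apply: eq_bigr => j _; rewrite mxE.
Qed.

Lemma diff_linf (V W : normedModType K) (L : {linear V -> W}) x : continuous L ->
  differentiable (fun y => L y) x.
Proof. exact: linear_differentiable. Qed.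

Lemma diff_linE (V W : normedModType K) (L : {linear V -> W}) x v : continuous L ->
  'd (fun y => L y) x v = L v.
Proof. by move=> cL; have /= -> := congr1 (@^~ v) (diff_lin x cL). Qed.

Lemma diff_lin_sub (U V W : normedModType K) (L : {linear V -> W}) (f : U -> V)
    (c : V) x : continuous L -> differentiable f x ->
  differentiable (fun y => L (f y - c)) x /\
  forall v, 'd (fun y => L (f y - c)) x v = L ('d f x v).
Proof.
move=> cL df; have ds : differentiable (fun y => f y - c) x.
  by apply: diff_sub => //; exact: differentiable_cst.
have dL y : differentiable (fun z => L z) y by exact: diff_linf.
split=> [|v]; first exact: (diff_compf ds (dL _)).
rewrite (diff_compfE v ds (dL _)) (diff_linE _ _ cL).
by rewrite (diff_subE v df (differentiable_cst c x)) diff_cstE subr0.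
Qed.

End AbstractMaps.

Section Linearization.
Variables (R : realType) (n : nat) (phi : CxCn R n -> Cn R n) (p : Cn R n).
Hypothesis act : holomorphic_Cstar_action phi.
Hypothesis fixp : fixed_point phi p.
Local Notation C := (R[i]^o : normedModType R[i]).
Local Notation twopii := (twopii R).
Local Notation V := (Cn R n).

Definition flow (w : C) (x : V) : V := phi (cexp w, x).

Lemma flow0 (x : V) : flow 0 x = x.
Proof. by rewrite /flow cexp0; case: act. Qed.

Lemma flowD (w w' : C) (x : V) : flow (w + w') x = flow w (flow w' x).
Proof. by rewrite /flow cexpD; case: act => _ _ ->//; exact: cexp_neq0. Qed.

Lemma flow_periodic (w : C) (x : V) : flow (w + twopii) x = flow w x.
Proof. by rewrite /flow cexp_periodic. Qed.

Lemma flow_fixed (w : C) : flow w p = p.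
Proof. by rewrite /flow fixp// cexp_neq0. Qed.

Lemma flowNK (w : C) (x : V) : flow (- w) (flow w x) = x.
Proof. by rewrite -flowD addNr flow0. Qed.

Lemma flow_diff (q : (C * V)%type) : differentiable (fun q : (C * V)%type => flow q.1 q.2) q.
Proof.
case: act => dphi _ _.
have d1 : differentiable (fun q : (C * V)%type => cexp q.1) q.
  exact: (diff_compf (diff_fst q) (cexp_entire _)).
exact: (diff_compf (diff_pairf d1 (diff_snd q)) (dphi _ _ (cexp_neq0 _))).
Qed.

Lemma flow_diff_space (w : C) (x : V) : differentiable (flow w) x.
Proof.
exact: (diff_compf (diff_pairf (differentiable_cst w x) (diff_id x)) (flow_diff (w, x))).
Qed.

Lemma flow_diff_time (x : V) (w : C) : differentiable (fun w => flow w x) w.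
Proof.
exact: (diff_compf (diff_pairf (diff_id w) (differentiable_cst x w)) (flow_diff (w, x))).
Qed.

Definition lin (w : C) : {linear V -> V} := 'd (flow w) p.

Lemma lin_continuous (w : C) : continuous (lin w).
Proof. exact: (diff_continuous (flow_diff_space w p)). Qed.

Lemma lin0 (v : V) : lin 0 v = v.
Proof.
have E : flow 0 = (fun x => x) by apply/funext => x; exact: flow0.
by rewrite /lin E; exact: diff_idE.
Qed.

Lemma linD (w w' : C) (v : V) : lin (w + w') v = lin w (lin w' v).
Proof.
have E : flow (w + w') = (fun x => flow w (flow w' x)).
  by apply/funext => x; exact: flowD.
rewrite /lin E; apply: etrans (diff_compfE v (flow_diff_space w' p) _) _.
  exact: flow_diff_space.
by rewrite flow_fixed.
Qed.

Lemma lin_periodic (w : C) (v : V) : lin (w + twopii) v = lin w v.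
Proof.
have E : flow (w + twopii) = flow w by apply/funext => x; exact: flow_periodic.
by rewrite /lin E.
Qed.

Lemma lin_cexp (w w' : C) : cexp w = cexp w' -> lin w = lin w'.
Proof.
move=> e; have E : flow w = flow w' by apply/funext => x; rewrite /flow e.
by rewrite /lin E.
Qed.

Lemma linNK (w : C) (v : V) : lin (- w) (lin w v) = v.
Proof. by rewrite -linD addNr lin0. Qed.

(* Cauchy's formula for the derivative along [v] makes the holomorphy of
   [w |-> lin w v] a case of differentiation under the mean. *)
Lemma lin_entire (v : V) (j : 'I_n) (w : C) :
  differentiable (fun w => lin w v ord0 j : C) w.
Proof.
(* [q.1] runs along the circle of Cauchy's formula and [q.2] is the time; the 0 is the logarithm of
   the radius 1. *)
pose g (q : (C * C)%type) : C :=
  (flow q.2 (p + cexp (0 + q.1) *: v) ord0 j - p ord0 j) * cexp (- (0 + q.1)).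
have dline (a : C) : differentiable (fun t : C => p + t *: v) a.
  by have [] := is_diff_affine p v a.
have de (q : (C * C)%type) : differentiable (fun q : (C * C)%type => cexp (0 + q.1)) q.
  apply: (diff_compf _ (cexp_entire _)).
  exact: (diff_compf (diff_fst q) (diff_add_cst _ _)).
have deN (q : (C * C)%type) : differentiable (fun q : (C * C)%type => cexp (- (0 + q.1))) q.
  apply: (diff_compf _ (cexp_entire _)); apply: diff_opp.
  exact: (diff_compf (diff_fst q) (diff_add_cst _ _)).
have dg (q : (C * C)%type) : differentiable g q.
  apply: diff_mul; last exact: deN.
  apply: diff_sub; last exact: differentiable_cst.
  apply: (diff_compf _ (diff_coord j _)).
  have d2 := diff_compf (de q) (dline _).
  exact: (diff_compf (diff_pairf (diff_snd q) d2) (flow_diff _)).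
have dgw (a b : C) : differentiable (fun b => g (a, b)) b.
  exact: (diff_compf (diff_pairf (differentiable_cst a b) (diff_id b)) (dg (a, b))).
have [D _] := mean_holomorphic (entire_cts dg) dgw w.
have -> // : (fun w => lin w v ord0 j : C) = (fun b => mean (fun a => g (a, b))).
apply/funext => b; rewrite -(diff_coordE v j (flow_diff_space b p)).
pose f (x : V) : C := flow b x ord0 j.
have df x : differentiable f x by exact: (diff_compf (flow_diff_space b x) (diff_coord j _)).
have := mean_derivative 0 0 (entire_line p v df).
rewrite (diff_line _ _ _ df) scale0r addr0 => <-.
apply: eq_mean => a; rewrite /g /f /= flow_fixed.
by rewrite (add0r (cexp _)).
Qed.

End Linearization.

(** * The averaged map *)

Lemma mean_sum (R : realType) (I : Type) (s : seq I) (f : I -> R[i]^o -> R[i]^o) :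
  (forall k, cts (f k)) ->
  mean (fun w => \sum_(k <- s) f k w) = \sum_(k <- s) mean (f k).
Proof.
move=> cf.
have cs r : cts (fun w => \sum_(k <- r) f k w).
  elim: r => [|k r IH].
    rewrite (_ : (fun w => _) = (fun=> 0)); first exact: cts_cst.
    by apply/funext => w; rewrite big_nil.
  rewrite (_ : (fun w => _) = (fun w => f k w + \sum_(k <- r) f k w)).
    exact (ctsD (cf k) IH).
  by apply/funext => w; rewrite big_cons.
elim: s => [|k r IH].
  by rewrite big_nil -[RHS]mean_cst; apply: eq_mean => w; rewrite big_nil.
rewrite big_cons -IH -(meanD (cf k) (cs r)).
by apply: eq_mean => w; rewrite big_cons.
Qed.

Section Averaging.
Variables (R : realType) (n : nat) (phi : CxCn R n -> Cn R n) (p : Cn R n).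
Hypothesis act : holomorphic_Cstar_action phi.
Hypothesis fixp : fixed_point phi p.
Local Notation C := (R[i]^o : normedModType R[i]).
Local Notation twopii := (twopii R).
Local Notation V := (Cn R n).
Local Notation flow := (flow phi).
Local Notation lin := (lin phi p).

Lemma lin_coord (w : C) (u : V) (j : 'I_n) :
  lin w u ord0 j = \sum_k u ord0 k * lin w (delta_mx ord0 k : 'rV[R[i]]_n) ord0 j.
Proof.
rewrite {1}(row_sum_delta u) linear_sum summxE; apply: eq_bigr => k _.
by rewrite linearZ mxE.
Qed.

Definition twisted (q : (C * V)%type) : V := lin (- q.1) (flow q.1 q.2 - p).

(** Expansion in the standard basis separates the variables: in each term [lin (- w)] acts on a
    fixed vector, the case settled by [lin_entire]. *)
Lemma twisted_diff (j : 'I_n) (q : (C * V)%type) :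
  differentiable (fun q => twisted q ord0 j : C) q.
Proof.
have -> : (fun q => twisted q ord0 j : C) = (fun q : (C * V)%type => \sum_k
    ((flow q.1 q.2 ord0 k - p ord0 k) *
     lin (- q.1) (delta_mx ord0 k : 'rV[R[i]]_n) ord0 j : C)).
  apply/funext => r; rewrite /twisted lin_coord.
  by apply: eq_bigr => k _; rewrite !mxE.
apply: diff_sum => k; apply: diff_mul.
  apply: diff_sub; last exact: differentiable_cst.
  exact: (diff_compf (flow_diff act q) (diff_coord k _)).
apply: (diff_compf (g := fun w : C => lin w (delta_mx ord0 k : 'rV[R[i]]_n) ord0 j : C)).
  exact: (diff_opp (diff_fst q)).
exact: lin_entire.
Qed.

Lemma twisted_diff_space (w : C) (j : 'I_n) (x : V) :
  differentiable (fun x => twisted (w, x) ord0 j : C) x.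
Proof.
exact: (diff_compf (diff_pairf (differentiable_cst w x) (diff_id x))
  (twisted_diff j (w, x))).
Qed.

Lemma twisted_diff_time (x : V) (j : 'I_n) (w : C) :
  differentiable (fun w => twisted (w, x) ord0 j : C) w.
Proof.
exact: (diff_compf (diff_pairf (diff_id w) (differentiable_cst x w))
  (twisted_diff j (w, x))).
Qed.

Lemma twisted_periodic (w : C) (x : V) : twisted (w + twopii, x) = twisted (w, x).
Proof.
have E : - w = - (w + twopii) + twopii by rewrite opprD subrK.
rewrite /twisted /= flow_periodic E.
exact (esym (lin_periodic phi p (- (w + twopii)) (flow w x - p))).
Qed.

Definition avg (x : V) : V := \row_j mean (fun w => twisted (w, x) ord0 j : C).

Lemma avg_coord_diff (j : 'I_n) (x : V) :
  differentiable (fun x => mean (fun w => twisted (w, x) ord0 j : C)) x /\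
  forall v, 'd (fun x => mean (fun w => twisted (w, x) ord0 j : C)) x v =
    mean (fun w => 'd (fun x => twisted (w, x) ord0 j : C) x v).
Proof.
exact: (mean_holomorphic (entire_cts (twisted_diff j))
  (fun w => twisted_diff_space w j) x).
Qed.

Lemma avg_diff (x : V) : differentiable avg x.
Proof. by apply: diff_row => j; have [] := avg_coord_diff j x. Qed.

Lemma avg_fixed : avg p = 0.
Proof.
apply/rowP => j; rewrite !mxE -[RHS]mean_cst; apply: eq_mean => w.
by rewrite /twisted /= flow_fixed// subrr linear0 mxE.
Qed.

Lemma avg_derivative (v : V) : 'd avg p v = v.
Proof.
apply/rowP => j; rewrite -(diff_coordE v j (avg_diff p)).
have -> : (fun x => avg x ord0 j : C) = (fun x => mean (fun w => twisted (w, x) ord0 j : C)).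
  by apply/funext => x; rewrite mxE.
have [_ ->] := avg_coord_diff j p.
rewrite -[RHS]mean_cst; apply: eq_mean => w.
have [D E] := diff_lin_sub p (lin_continuous (p := p) act (w := - w)) (flow_diff_space act w p).
by rewrite (diff_coordE v j D) E /= (linNK act fixp).
Qed.

(** The integrand at [flow a x] is [lin a] of the integrand at [x] with time shifted by [a]. The
    linear factor leaves the mean coordinate by coordinate, and [mean_shift] absorbs the shift even
    when [a] is not imaginary. *)
Lemma avg_equivariant (a : C) (x : V) : avg (flow a x) = lin a (avg x).
Proof.
apply/rowP => j; rewrite mxE lin_coord.
have -> : mean (fun w => twisted (w, flow a x) ord0 j : C) =
  mean (fun w => \sum_k (lin a (delta_mx ord0 k : 'rV[R[i]]_n) ord0 j *
    twisted (a + w, x) ord0 k : C)).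
  apply: eq_mean => w.
  have -> : twisted (w, flow a x) = lin a (twisted (a + w, x)).
    rewrite /twisted /=.
    have -> : flow w (flow a x) = flow (a + w) x by rewrite addrC (flowD act).
    have Ew : - w = a + - (a + w) by rewrite opprD addrA subrr sub0r.
    rewrite {1}Ew; exact (linD act fixp a (- (a + w)) _).
  by rewrite lin_coord; apply: eq_bigr => k _; rewrite mulrC.
have cT k : cts (fun w => twisted (w, x) ord0 k : C).
  exact: entire_cts (twisted_diff_time x k).
have cTa k : cts (fun w => twisted (a + w, x) ord0 k : C).
  apply: (cts_comp (f := fun w : C => a + w : C) _ (cT k)).
  by apply: entire_cts; exact: diff_add_cst.
rewrite mean_sum; last first.
  by move=> k; exact (ctsM (@cts_cst R[i] C C _) (cTa k)).
apply: eq_bigr => k _; rewrite (meanZ _ (cTa k)) mulrC; congr (_ * _).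
rewrite mxE; apply: (mean_shift a (twisted_diff_time x k)) => w.
by rewrite twisted_periodic.
Qed.

End Averaging.

(** * Near-identity maps and differentiability of local inverses *)

Section LocalInverse.
Variables (R : realType) (n : nat).
Local Notation C := (R[i]^o : normedModType R[i]).
Local Notation V := (Cn R n).

Lemma near_identity_lipschitz (F : V -> V) (p : V) :
  (forall x, differentiable F x) -> F p = 0 -> (forall v, 'd F p v = v) ->
  exists2 d : R, 0 < d & forall x y, nrm (x - p) <= d -> nrm (y - p) <= d ->
    nrm ((F x - x) - (F y - y)) <= 2^-1 * nrm (x - y).
Proof.
move=> dF Fp DF.
(* With the bound [rho / 16] on [H], the constant [8 * M / rho] of [ball_lipschitz] becomes 1/2. *)
have [e e0 He] := diff_nrm (dF p) (e := 16^-1) ltac:(by rewrite invr_gt0).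
pose rho := e / 2; have rho0 : 0 < rho by rewrite divr_gt0.
pose H (x : V) : V := F x - (x - p).
have dH x : differentiable H x.
  apply: diff_sub; first exact: dF.
  by apply: diff_sub; [exact: diff_id|exact: differentiable_cst].
have HM (j : 'I_n) y : nrm (y - p) <= rho -> nrm (H y ord0 j : C) <= 16^-1 * rho.
  move=> yr; apply: le_trans (nrm_coord _ _) _.
  have ye : nrm (y - p) < e by rewrite (le_lt_trans yr)// ltr_pdivrMr// ltr_pMr// ltr1n.
  have := He _ ye; rewrite DF Fp subr0 (addrC p) subrK => h.
  by apply: le_trans h _; rewrite ler_pM2l.
exists (rho / 8); first by rewrite divr_gt0.
move=> x y xr yr.
have -> : F x - x - (F y - y) = H x - H y.
  by rewrite /H; apply/rowP => j; rewrite !mxE; ring.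
apply: nrm_vec_le => [|j]; first by rewrite mulr_ge0 ?nrm_ge0.
have := ball_lipschitz (fun y => diff_compf (dH y) (diff_coord j (H y))) rho0 (HM j) xr yr.
rewrite !mxE; congr (_ <= _ * _); field.
by rewrite gt_eqF.
Qed.

(** The intervals centred at [a k] with radius [2 * D * 2^-1 ^+ k] are nested, because the tail of
    the geometric series fits in the radius. *)
Lemma geometric_limit_real (a : nat -> R) (D : R) :
  (forall k, `|a k.+1 - a k| <= D * 2^-1 ^+ k) ->
  exists l, forall k, `|a k - l| <= 2 * D * 2^-1 ^+ k.
Proof.
move=> H; have D0 : 0 <= D by have := H 0; rewrite expr0 mulr1; apply: le_trans.
have e0 k : 0 <= 2^-1 ^+ k :> R by rewrite exprn_ge0.
have [||k|l Hl] := @nested_point _ (fun k => a k - 2 * D * 2^-1 ^+ k)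
    (fun k => 4 * D * 2^-1 ^+ k).
- move=> k; have := H k; rewrite ler_norml => /andP[h _]; rewrite exprSr.
  by move: h; move: (2^-1 ^+ k) => q; lra.
- move=> k; have := H k; rewrite ler_norml => /andP[_ h]; rewrite exprSr.
  by move: h; move: (2^-1 ^+ k) => q; lra.
- by rewrite !mulr_ge0.
exists l => k; have /andP[] := Hl k; rewrite ler_norml.
by move: (2^-1 ^+ k) => q; lra.
Qed.

Lemma geometric_limit (u : nat -> V) (D : R) :
  (forall k, nrm (u k.+1 - u k) <= D * 2^-1 ^+ k) ->
  exists l, forall k, nrm (u k - l) <= 4 * D * 2^-1 ^+ k.
Proof.
move=> H.
have D0 : 0 <= D by have := H 0; rewrite expr0 mulr1; apply: le_trans; exact: nrm_ge0.
have e0 k : 0 <= 2^-1 ^+ k :> R by rewrite exprn_ge0.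
have Hj j k : nrm (u k.+1 ord0 j - u k ord0 j : C) <= D * 2^-1 ^+ k.
  by apply: le_trans (H k); have := nrm_coord (u k.+1 - u k) j; rewrite !mxE.
have HR j : exists l, forall k, `|complex.Re (u k ord0 j) - l| <= 2 * D * 2^-1 ^+ k.
  apply: geometric_limit_real => k; apply: le_trans (Hj j k).
  by rewrite -Re_sub; exact: nrm_Re.
have HI j : exists l, forall k, `|complex.Im (u k ord0 j) - l| <= 2 * D * 2^-1 ^+ k.
  apply: geometric_limit_real => k; apply: le_trans (Hj j k).
  by rewrite -Im_sub; exact: nrm_Im.
have [lR hR] := choice HR; have [lI hI] := choice HI.
exists (\row_j (lR j +i* lI j)) => k; apply: nrm_vec_le => [|j].
  by rewrite !mulr_ge0.
rewrite !mxE; apply: le_trans (nrm_le_ReIm _) _; rewrite Re_sub Im_sub /=.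
have := hR j k; have := hI j k; move: (2^-1 ^+ k) => q; lra.
Qed.

Lemma nrm_sum (W : normedModType R[i]) (I : Type) (s : seq I) (f : I -> W) :
  nrm (\sum_(k <- s) f k) <= \sum_(k <- s) nrm (f k).
Proof.
elim: s => [|k s IH]; first by rewrite !big_nil nrm0.
by rewrite !big_cons; apply: le_trans (nrmD _ _) _; rewrite lerD2l.
Qed.

Lemma linear_rV_bounded (L : {linear V -> V}) :
  exists2 K : R, 0 < K & forall v, nrm (L v) <= K * nrm v.
Proof.
pose b (k : 'I_n) : V := delta_mx ord0 k.
exists (1 + \sum_k nrm (L (b k))).
  by rewrite ltr_pwDl// sumr_ge0// => k _; exact: nrm_ge0.
move=> v; rewrite {1}(row_sum_delta v) linear_sum; apply: le_trans (nrm_sum _ _) _.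
rewrite mulrDl mul1r mulr_suml; apply: le_trans (_ : _ <= \sum_k nrm (L (b k)) * nrm v) _.
  apply: ler_sum => k _; rewrite linearZ nrmZ mulrC.
  by rewrite ler_wpM2l ?nrm_ge0// nrm_coord.
by rewrite lerDr nrm_ge0.
Qed.

Section NearIdentity.
Variables (F : V -> V) (p : V) (d : R).
Hypothesis d0 : 0 < d.
Hypothesis Fp : F p = 0.
Hypothesis lipF : forall x y, nrm (x - p) <= d -> nrm (y - p) <= d ->
  nrm ((F x - x) - (F y - y)) <= 2^-1 * nrm (x - y).

Lemma near_identity_expanding x y : nrm (x - p) <= d -> nrm (y - p) <= d ->
  nrm (x - y) <= 2 * nrm (F x - F y).
Proof.
move=> xd yd; have h := lipF xd yd.
have : nrm (x - y) <= nrm (F x - F y) + nrm ((F x - x) - (F y - y)).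
  have {1}-> : x - y = (F x - F y) - ((F x - x) - (F y - y)).
    by apply/rowP => j; rewrite !mxE; ring.
  exact: nrmB.
lra.
Qed.

Lemma near_identity_fixed_norm x : nrm (x - p) <= d -> nrm (x - p) <= 2 * nrm (F x).
Proof.
move=> xd; have pd : nrm (p - p) <= d by rewrite subrr nrm0 ltW.
by have := near_identity_expanding xd pd; rewrite Fp subr0.
Qed.

Lemma near_identity_onto y : nrm y <= d / 4 -> exists2 x, nrm (x - p) < d & F x = y.
Proof.
move=> yd; have y0 := nrm_ge0 y; have dd := d0.
(* A fixed point of [T] solves [F x = y], and [T] contracts by 1/2. The first step from [p] has
   length [nrm y <= d / 4], so the iterates stay within [d / 2] of [p]. *)
pose T (x : V) : V := y + x - F x.
pose u := fix u k : V := if k is k'.+1 then T (u k') else p.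
have e1 k : 0 <= (2^-1 : R) ^+ k <= 1.
  by rewrite exprn_ge0//= exprn_ile1// invf_le1// ler1n.
have inv k : nrm (u k - p) <= d / 2 * (1 - 2^-1 ^+ k) /\
    nrm (u k.+1 - u k) <= d / 4 * 2^-1 ^+ k.
  elim: k => [|k [IH1 IH2]].
    rewrite expr0 (subrr (1 : R)) mulr0 mulr1 /= (subrr p) nrm0 lexx /T Fp subr0.
    by rewrite addrK.
  have uS : nrm (u k.+1 - p) <= d / 2 * (1 - 2^-1 ^+ k.+1).
    apply: le_trans (nrm_tri (u k) _ _) _; rewrite exprSr.
    by move: IH1 IH2; move: (2^-1 ^+ k) => q; lra.
  split=> //.
  have b1 : nrm (u k - p) <= d by have := e1 k; nra.
  have b2 : nrm (u k.+1 - p) <= d by have := e1 k.+1; nra.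
  have := lipF b2 b1.
  have -> : u k.+2 - u k.+1 = - ((F (u k.+1) - u k.+1) - (F (u k) - u k)).
    rewrite -[u k.+2]/(T (u k.+1)) -[X in _ - X = _]/(T (u k)) /T.
    by apply/rowP => j; rewrite !mxE; ring.
  rewrite nrmN exprSr => h; apply: le_trans h _.
  by move: IH2; move: (2^-1 ^+ k) => q; lra.
have [l Hl] := geometric_limit (fun k => (inv k).2).
have small e : 0 < e -> exists k, d * 2^-1 ^+ k < e.
  move=> e0; have : (fun k => 2^-1 ^+ k) @ \oo --> (0 : R).
    by apply: cvg_expr; rewrite ger0_norm; lra.
  move=> /cvgrPdist_lt/(_ (e / d))[|k _ /(_ k (leqnn k))]; first by rewrite divr_gt0.
  rewrite sub0r normrN ger0_norm ?exprn_ge0// ltr_pdivlMr// => h.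
  by exists k; rewrite mulrC.
have ld : nrm (l - p) <= d.
  apply/ler_addgt0Pr => e e0; have [k ke] := small e e0.
  apply: le_trans (nrm_tri (u k) _ _) _; rewrite nrm_distC.
  have [h1 _] := inv k; have := Hl k; have := e1 k.
  by move: h1 ke; move: (2^-1 ^+ k) => q; nra.
have Fl : F l = y.
  apply/eqP; rewrite -subr_eq0; apply/eqP/nrm_eq0/eqP; rewrite eq_le nrm_ge0 andbT.
  apply/ler_addgt0Pr => e e0; rewrite add0r.
  have [k ke] := small (e / 2) ltac:(by rewrite divr_gt0).
  have [h1 _] := inv k.
  have b1 : nrm (u k - p) <= d by have := e1 k; nra.
  have := lipF b1 ld => h2.
  have -> : F l - y = (l - u k.+1) - ((F (u k) - u k) - (F l - l)).
    rewrite -[u k.+1]/(T (u k)) /T; apply/rowP => j; rewrite !mxE; ring.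
  apply: le_trans (nrmB _ _) _; rewrite (nrm_distC l).
  have := Hl k; have := Hl k.+1; rewrite exprSr.
  by move: ke h2; move: (2^-1 ^+ k) => q; lra.
exists l => //; apply: le_lt_trans (near_identity_fixed_norm ld) _.
rewrite Fl; apply: (@le_lt_trans _ _ (2 * (d / 4))); first by rewrite ler_pM2l.
lra.
Qed.

(** In a direction killed by the differential, a short step moves [F] by at most a quarter of its
    length, whereas [near_identity_expanding] demands at least half. *)
Lemma near_identity_diff_inj (x v : V) : differentiable F x -> nrm (x - p) < d ->
  'd F x v = 0 -> v = 0.
Proof.
move=> dF xd Dv; apply: nrm_eq0; apply/eqP; rewrite eq_le nrm_ge0 andbT.
have [r r0 Hr] := diff_nrm dF (e := 4^-1) ltac:(by rewrite invr_gt0).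
pose N := nrm v + 1; have v0 := nrm_ge0 v; have N0 : 0 < N by rewrite /N; lra.
pose s := Num.min r (d - nrm (x - p)) / (2 * N).
have m0 : 0 < Num.min r (d - nrm (x - p)) by rewrite lt_min r0 subr_gt0.
have s0 : 0 < s by rewrite divr_gt0// mulr_gt0.
have sN : s * nrm v < Num.min r (d - nrm (x - p)).
  have : s * (2 * N) = Num.min r (d - nrm (x - p)).
    by rewrite /s divfK// gt_eqF// mulr_gt0.
  by move: m0; move: (Num.min _ _) => m m0 <-; rewrite ltr_pM2l// /N; lra.
clearbody s; move: sN; rewrite lt_min => /andP[sr sd].
have nsv : nrm (s%:C *: v) = s * nrm v by rewrite nrmZ nrmR gtr0_norm.
have := Hr (s%:C *: v); rewrite nsv => /(_ sr).
rewrite linearZ /= Dv scaler0 subr0 => A1.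
have xs : nrm (x + s%:C *: v - p) <= d.
  by rewrite addrAC; apply: le_trans (nrmD _ _) _; rewrite nsv; lra.
have := near_identity_expanding xs (ltW xd).
rewrite (addrC x) addrK nsv addrC => A2.
rewrite -(ler_pM2l s0) mulr0.
by move: A1 A2; rewrite addrC; lra.
Qed.

End NearIdentity.

(** In finite dimension an injective differential has an inverse [L]. With [k] the increment of [G],
    the error for [G] is [- L (h - 'd F x k)]: this is small relative to [k], hence relative to [h]
    by the Lipschitz bound [c]. *)
Lemma inverse_diff (F G : V -> V) (x : V) (r c : R) : differentiable F x ->
  (forall v, 'd F x v = 0 -> v = 0) -> G (F x) = x -> 0 < r ->
  (forall y, nrm (y - F x) < r -> F (G y) = y /\ nrm (G y - x) <= c * nrm (y - F x)) ->
  differentiable G (F x).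
Proof.
move=> dF inj Gx r0 HG.
pose M : 'M[R[i]]_n := lin1_mx ('d F x).
have ME (v : V) : 'd F x v = v *m M by rewrite mul_rV_lin1.
have uM : M \in unitmx.
  rewrite -row_free_unit -kermx_eq0; apply/eqP/row_matrixP => i.
  rewrite row0; apply: inj; rewrite ME; apply/eqP.
  by rewrite -sub_kermx row_sub.
pose L : {linear V -> V} := mulmxr (invmx M).
have LE (v : V) : L ('d F x v) = v by rewrite ME /= mulmxK.
have [K K0 HK] := linear_rV_bounded L.
suff [] : is_diff (F x) G L by [].
apply: (is_diff_nrm HK) => e e0; rewrite Gx.
have c0 : 0 < `|c| + 1 by have := normr_ge0 c; lra.
have [q q0 Hq] := diff_nrm dF (e := e / (K * (`|c| + 1)))
  ltac:(by rewrite divr_gt0// mulr_gt0).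
exists (Num.min r (q / (`|c| + 1))); first by rewrite lt_min r0 divr_gt0.
move=> h; rewrite lt_min => /andP[hr hq].
have [|FG GL] := HG (F x + h); first by rewrite addrC addKr.
have Eh : F x + h - F x = h by rewrite (addrC (F x)) addrK.
move: GL; rewrite Eh => GL.
pose k : V := G (F x + h) - x.
have kh : nrm k <= (`|c| + 1) * nrm h.
  apply: le_trans GL _; apply: ler_wpM2r; first exact: nrm_ge0.
  by have := ler_norm c; lra.
have kq : nrm k < q.
  apply: le_lt_trans kh _; move: hq; rewrite ltr_pdivlMr//.
  by rewrite mulrC.
have := Hq k kq.
have -> : x + k = G (F x + h) by rewrite /k addrC subrK.
rewrite FG Eh => Q.
have -> : G (F x + h) - x - L h = - L (h - 'd F x k).
  by rewrite linearB LE opprB.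
rewrite nrmN; apply: le_trans (HK _) _.
apply: le_trans (ler_wpM2l (ltW K0) Q) _.
apply: le_trans (ler_wpM2l (ltW K0) (ler_wpM2l _ kh)) _.
  by rewrite ltW// divr_gt0// mulr_gt0.
rewrite le_eqVlt; apply/orP; left; apply/eqP; field.
by rewrite !gt_eqF.
Qed.

End LocalInverse.

(** * Circle-invariant neighbourhoods of the origin *)

Section InvariantNeighbourhood.
Variables (R : realType) (n : nat) (phi : CxCn R n -> Cn R n) (p : Cn R n).
Hypothesis act : holomorphic_Cstar_action phi.
Hypothesis fixp : fixed_point phi p.
Local Notation C := (R[i]^o : normedModType R[i]).
Local Notation twopii := (twopii R).
Local Notation V := (Cn R n).
Local Notation flow := (flow phi).
Local Notation lin := (lin phi p).
Local Notation F := (avg phi p).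

(** Extends bounds over the segment used by [mean] to the whole imaginary axis. *)
Lemma circle_param (w : C) : complex.Re w = 0 ->
  exists2 t : R, 0 <= t <= 1 & cexp (t%:C * twopii) = cexp w.
Proof.
case: w => x y /= ->; pose c := cos y.
have pi0 : 0 < pi *+ 2 :> R by rewrite mulrn_wgt0// pi_gt0.
have cI : -1 <= c <= 1 by rewrite cos_geN1 cos_le1.
have pE : (pi *+ 2 : R) = pi + pi by rewrite mulr2n.
have a0 : 0 <= acos c by exact: acos_ge0.
have a1 : acos c <= pi by exact: acos_lepi.
have cE : cos (acos c) = cos y by rewrite acosK// in_itv.
have sE : sin (acos c) = `|sin y|.
  rewrite sin_acos// -(cos2Dsin2 y) addrAC subrr add0r sqrtr_sqr//.
have exE (b : R) : cexp ((b / (pi *+ 2))%:C * twopii) = cos b +i* sin b.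
  rewrite /cexp /= !mulr0 !mul0r subrr addr0 expR0 !mul1r divfK ?gt_eqF//.
have target : cexp (0 +i* y : C) = cos y +i* sin y by rewrite /cexp /= expR0 !mul1r.
rewrite target; have [s0|s0] := leP 0 (sin y).
  exists (acos c / (pi *+ 2)).
    apply/andP; split; first by apply: divr_ge0; lra.
    by rewrite ler_pdivrMr// mul1r; lra.
  by rewrite exE cE sE ger0_norm.
exists ((- acos c + pi *+ 2) / (pi *+ 2)).
  apply/andP; split; first by apply: divr_ge0; lra.
  by rewrite ler_pdivrMr// mul1r; lra.
by rewrite exE cosD2pi sinD2pi cosN sinN cE sE ltr0_norm// opprK.
Qed.

Lemma lin_jointly_diff (j : 'I_n) (q : (C * V)%type) :
  differentiable (fun q : (C * V)%type => lin q.1 q.2 ord0 j : C) q.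
Proof.
have -> : (fun q : (C * V)%type => lin q.1 q.2 ord0 j : C) =
    (fun q : (C * V)%type => \sum_k (q.2 ord0 k *
     lin q.1 (delta_mx ord0 k : 'rV[R[i]]_n) ord0 j : C)).
  by apply/funext => r; rewrite lin_coord.
apply: diff_sum => k; apply: diff_mul.
  exact: (diff_compf (diff_snd q) (diff_coord k _)).
apply: (diff_compf (g := fun w : C => lin w (delta_mx ord0 k : 'rV[R[i]]_n) ord0 j : C)).
  exact: diff_fst.
exact: lin_entire.
Qed.

(** [circle_bound] at the origin gives a bound on a ball of radius [d] uniformly in the circle;
    rescaling [y] to norm [d] makes it homogeneous. *)
Lemma lin_circle_bound : exists2 K : R, 0 < K &
  forall w y, complex.Re w = 0 -> nrm (lin w y) <= K * nrm y.
Proof.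
have H (j : 'I_n) : exists K : R, 0 <= K /\ forall w y, complex.Re w = 0 ->
    nrm (lin w y ord0 j : C) <= K * nrm y.
  have [d [M [d0 M0 HM]]] := circle_bound (entire_cts (lin_jointly_diff j)) 0.
  exists (M / d); split=> [|w y /circle_param[t t01 /(lin_cexp phi p) <-]].
    by rewrite divr_ge0// ltW.
  have [->|y0] := eqVneq y 0; first by rewrite linear0 mxE !nrm0 mulr0.
  have yp := nrm_gt0 y0.
  have := HM t ((d / nrm y)%:C *: y) t01.
  rewrite subr0 nrmZ nrmR gtr0_norm ?divr_gt0// divfK ?gt_eqF// lexx => /(_ isT).
  rewrite /= linearZ mxE nrmM nrmR gtr0_norm ?divr_gt0//.
  by rewrite -ler_pdivlMl ?divr_gt0// invf_div mulrAC (mulrC (nrm y)) mulrAC.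
have [K HK] := choice H.
exists (1 + \sum_j K j) => [|w y w0].
  by rewrite ltr_pwDl// sumr_ge0// => j _; have [] := HK j.
have S0 j : K j <= 1 + \sum_j K j.
  rewrite (bigD1 j)//=; have : 0 <= \sum_(i < n | i != j) K i.
    by rewrite sumr_ge0// => i _; have [] := HK i.
  lra.
apply: nrm_vec_le => [|j].
  by rewrite mulr_ge0 ?nrm_ge0// addr_ge0// sumr_ge0// => j _; have [] := HK j.
have [_ /(_ w y w0) h] := HK j; apply: le_trans h _.
by rewrite ler_wpM2r ?nrm_ge0.
Qed.

(* The strict margin [s < r] makes this circle-invariant set open. *)
Definition circle_ball (r : R) : set V :=
  [set y | exists2 s : R, s < r & forall w, complex.Re w = 0 -> nrm (lin w y) <= s].

Lemma circle_ball0 (r : R) : 0 < r -> circle_ball r 0.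
Proof. by move=> r0; exists 0 => // w _; rewrite linear0 nrm0. Qed.

Lemma circle_ball_nrm (r : R) y : circle_ball r y -> nrm y < r.
Proof. by move=> [s sr /(_ 0 erefl)]; rewrite (lin0 _ act) => /le_lt_trans; apply. Qed.

Lemma circle_ball_open (r : R) : open (circle_ball r).
Proof.
have [K K0 HK] := lin_circle_bound.
rewrite openE => y [s sr Hs]; apply/nbhs_nrmP.
exists ((r - s) / (2 * K)); first by rewrite divr_gt0 ?subr_gt0// mulr_gt0.
move=> z; rewrite ltr_pdivlMr ?mulr_gt0// => zy.
exists ((r + s) / 2) => [|w w0]; first lra.
rewrite -[z](subrK y) linearD; apply: le_trans (nrmD _ _) _.
have h1 := Hs w w0; have h2 := HK w (z - y) w0.
apply: le_trans (lerD h2 h1) _; lra.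
Qed.

Lemma circle_ball_path (r : R) y (z : C) : circle_ball r y -> circle_ball r (lin z y) ->
  forall t : R, 0 <= t <= 1 -> nrm (lin (t%:C * z) y) < r.
Proof.
move=> [s1 s1r H1] [s2 s2r H2] t /andP[t0 t1].
pose K := Num.max s1 s2.
have Kr : K < r by rewrite gt_max s1r.
have K0 : 0 <= K.
  by rewrite le_max; apply/orP; left; apply: le_trans (nrm_ge0 _) (H1 0 erefl).
apply: le_lt_trans Kr; apply: nrm_vec_le => // j.
pose h (w : C) : C := lin w y ord0 j.
have dh w : differentiable h w by exact: lin_entire.
have hper w : h (w + twopii) = h w.
  exact (congr1 (fun u : V => u ord0 j : C) (lin_periodic phi p w y)).
have hK w u : nrm (lin w y) <= u -> nrm (h w) <= u.
  by apply: le_trans; exact: nrm_coord.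
have B1 w : complex.Re w = 0 -> nrm (h w) <= K.
  by move=> /H1 w1; apply: hK; rewrite le_max w1.
have B2 w : complex.Re w = complex.Re z -> nrm (h w) <= K.
  move=> wz; apply: hK; rewrite -[w](subrK z) (linD act fixp).
  by rewrite le_max H2 ?orbT// Re_sub wz subrr.
have Rtz : complex.Re (t%:C * z : C) = t * complex.Re z.
  by case: z {H2 B2} => a b /=; rewrite mul0r subr0.
(* The sign of [Re z] tells which of the two lines is the left edge of the strip. *)
have [z0|z0] := leP 0 (complex.Re z).
  apply: (strip_max dh hper B1 B2); rewrite Rtz; apply/andP; split; nra.
apply: (strip_max dh hper B2 B1); rewrite Rtz; apply/andP; split; nra.
Qed.

End InvariantNeighbourhood.

(** * The invariant neighbourhood of the fixed point *)

Section Saturation.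
Variables (R : realType) (n : nat) (phi : CxCn R n -> Cn R n) (p : Cn R n).
Hypothesis act : holomorphic_Cstar_action phi.
Hypothesis fixp : fixed_point phi p.
Local Notation C := (R[i]^o : normedModType R[i]).
Local Notation V := (Cn R n).
Local Notation flow := (flow phi).
Local Notation lin := (lin phi p).
Local Notation F := (avg phi p).
Variable d : R.
Hypothesis d0 : 0 < d.
Hypothesis lipF : forall x y, nrm (x - p) <= d -> nrm (y - p) <= d ->
  nrm ((F x - x) - (F y - y)) <= 2^-1 * nrm (x - y).

Let Fp : F p = 0 := avg_fixed fixp.
Let dF x : differentiable F x := avg_diff act fixp x.
Let cF : continuous F := fun x => differentiable_continuous (dF x).

(** The radius [d / 4] serves twice: [near_identity_onto] attains all such values, and
    [near_identity_fixed_norm] confines their preimages in the [d]-ball to the [d / 2]-ball. *)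
Definition core : set V :=
  [set x | nrm (x - p) < d /\ circle_ball phi p (d / 4) (F x)].

Definition saturation : set V := [set x | exists w, core (flow w x)].

Lemma core_fixed : core p.
Proof.
split; first by rewrite subrr nrm0.
by rewrite Fp; apply: circle_ball0; rewrite divr_gt0.
Qed.

Lemma flow_continuous (w : C) : continuous (flow w).
Proof. by move=> x; apply: differentiable_continuous; exact: flow_diff_space. Qed.

Lemma open_core : open core.
Proof.
have o1 : open [set x : V | nrm (x - p) < d].
  rewrite openE => x xd; apply/nbhs_nrmP; exists (d - nrm (x - p)).
    by rewrite subr_gt0.
  by move=> y yx; apply: le_lt_trans (nrm_tri x _ _) _; lra.
have o2 : open (F @^-1` circle_ball phi p (d / 4)).
  by apply: open_comp (circle_ball_open act fixp (r := d / 4)) => x _; exact: cF.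
have -> : core = [set x : V | nrm (x - p) < d] `&` F @^-1` circle_ball phi p (d / 4) by [].
exact: openI.
Qed.

Lemma open_saturation : open saturation.
Proof.
have -> : saturation = \bigcup_w (flow w @^-1` core).
  by apply/seteqP; split => x [w]; [exists w|move=> _; exists w].
apply: bigcup_open => w _; apply: open_comp open_core => x _.
exact: flow_continuous.
Qed.

Lemma flow_saturation (a : C) x : saturation x -> saturation (flow a x).
Proof.
by move=> [w xw]; exists (w - a); rewrite -(flowD act) subrK.
Qed.

(* Along the orbit arc the image under [F] stays small, so the point cannot cross
   the shell between the radii [d / 2] and [d]. *)
Lemma core_return (z : C) u : core u -> circle_ball phi p (d / 4) (F (flow z u)) ->
  nrm (flow z u - p) <= d.
Proof.
move=> [ud Vu] Vz; rewrite leNgt; apply/negP => zd.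
have FE (t : R) : F (flow (t%:C * z) u) = lin (t%:C * z) (F u).
  exact (avg_equivariant act fixp _ _).
have Vz' : circle_ball phi p (d / 4) (lin z (F u)).
  by rewrite -(avg_equivariant act fixp).
pose D (t : R) := nrm (flow (t%:C * z) u - p).
have small t : 0 <= t <= 1 -> D t <= d -> D t < d / 2.
  move=> t01 Dt; have := near_identity_fixed_norm d0 Fp lipF Dt.
  move=> h; apply: le_lt_trans h _; rewrite FE.
  have := circle_ball_path act fixp Vu Vz' t01; lra.
have cD : continuous D.
  have c1 : cts (fun w : C => flow w u) := entire_cts (flow_diff_time act u).
  move=> t; apply/cvgrPdist_lt => e e0.
  have /cont_nrmP/(_ _ e0)[r r0 Hr] := c1 (t%:C * z).
  have z0 := nrm_ge0 z.
  apply/nbhs_normP; exists (r / (nrm z + 1)); first by rewrite /= divr_gt0//; lra.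
  move=> s /=; rewrite distrC ltr_pdivlMr; last lra.
  move=> st; have /Hr : nrm (s%:C * z - t%:C * z : C) < r.
    have -> : s%:C * z - t%:C * z = (s - t)%:C * z :> C by rewrite rmorphB mulrBl.
    by rewrite nrmM nrmR; have := normr_ge0 (s - t); nra.
  apply: le_lt_trans; rewrite /D ler_distl.
  have h1 := nrm_tri (flow (s%:C * z) u) (flow (t%:C * z) u) p.
  have h2 := nrm_tri (flow (t%:C * z) u) (flow (s%:C * z) u) p.
  rewrite (nrm_distC (flow (t%:C * z) u) (flow (s%:C * z) u)) in h1.
  move: h1 h2; move: (nrm _) (nrm _) (nrm _) => q1 q2 q3 h1 h2.
  by apply/andP; split; lra.
have D0 : D 0 < d / 2.
  by apply: small; rewrite ?lexx ?ler01// /D mul0r (flow0 act) ltW.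
have D1 : d < D 1 by rewrite /D mul1r.
have dd := d0.
(* Any value between [d / 2] and [d] would do: [small] forbids that shell. *)
have [||t] := IVT (f := D) (a := 0) (b := 1) (v := 3 / 4 * d) ler01.
- exact: continuous_subspaceT.
- by rewrite ge_min le_max; apply/andP; split; apply/orP; [left|right]; lra.
rewrite in_itv /= => t01 tE.
by have := small t t01; rewrite tE; lra.
Qed.

(** Both points are moved by the time [w'] that brings [y] into [core]. Their images still agree, so
    [core_return], started from [flow w x], puts the other one in the closed [d]-ball, where [F] is
    injective. *)
Lemma avg_inj_saturation x y : saturation x -> saturation y -> F x = F y -> x = y.
Proof.
move=> [w xw] [w' yw'] xy.
have E : flow (w' - w) (flow w x) = flow w' x by rewrite -(flowD act) subrK.
have FE : F (flow w' x) = F (flow w' y) by rewrite !(avg_equivariant act fixp) xy.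
have xd : nrm (flow w' x - p) <= d.
  by rewrite -E; apply: core_return => //; rewrite E FE; case: yw'.
have yd : nrm (flow w' y - p) <= d by case: yw' => /ltW.
have H : flow w' x = flow w' y.
  apply/eqP; rewrite -subr_eq0; apply/eqP/nrm_eq0/eqP.
  rewrite eq_le nrm_ge0 andbT; apply: le_trans (near_identity_expanding lipF xd yd) _.
  by rewrite FE subrr nrm0 mulr0.
by rewrite -(flowNK act w' x) H (flowNK act).
Qed.

Lemma core_onto v : circle_ball phi p (d / 4) v -> exists2 u, core u & F u = v.
Proof.
move=> vB; have vd := ltW (circle_ball_nrm act vB).
have [u ud uE] := near_identity_onto d0 Fp lipF vd.
by exists u => //; split=> //; rewrite uE.
Qed.

(** This describes the image as a union of preimages of an open set under the continuous maps
    [lin w], which gives its openness. *)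
Lemma image_saturation :
  F @` saturation = [set y | exists w, circle_ball phi p (d / 4) (lin w y)].
Proof.
apply/seteqP; split=> [_ [x [w [_ xw]] <-]|y [w /core_onto[u uc uE]]].
  by exists w; rewrite -(avg_equivariant act fixp).
exists (flow (- w) u); first by exists w; rewrite -{1}[w]opprK (flowNK act).
by rewrite (avg_equivariant act fixp) uE (linNK act fixp).
Qed.

Lemma open_image_saturation : open (F @` saturation).
Proof.
rewrite image_saturation.
have -> : [set y | exists w, circle_ball phi p (d / 4) (lin w y)] =
    \bigcup_w (lin w @^-1` circle_ball phi p (d / 4)).
  by apply/seteqP; split => x [w]; [exists w|move=> _; exists w].
apply: bigcup_open => w _; apply: open_comp (circle_ball_open act fixp (r := d / 4)).
by move=> x _; exact: lin_continuous.
Qed.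

(** Differentiating the equivariance carries the kernel at [x] into the kernel at a point of [core],
    which is trivial; the differential of the flow is invertible. *)
Lemma avg_diff_inj x v : saturation x -> 'd F x v = 0 -> v = 0.
Proof.
move=> [w [xd _]] Dv.
have dw := flow_diff_space act w x.
have E : (fun x => F (flow w x)) = (fun x => lin w (F x)).
  by apply/funext => y; exact: avg_equivariant.
have E1 := diff_compfE v dw (dF (flow w x)).
have cl : differentiable (fun y => lin w y) (F x).
  exact: (diff_linf _ (lin_continuous act (p := p) (w := w))).
have E2 := diff_compfE v (dF x) cl.
have D0 : 'd F (flow w x) ('d (flow w) x v) = 0.
  apply: etrans (esym E1) _; rewrite E; apply: etrans E2 _.
  apply: etrans (congr1 (fun u => 'd (fun y => lin w y) (F x) u) Dv) _.
  exact: linear0.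
have D1 := near_identity_diff_inj lipF (dF _) xd D0.
have E3 := diff_compfE v dw (flow_diff_space act (- w) (flow w x)).
have E4 : (fun x => flow (- w) (flow w x)) = (fun x => x).
  by apply/funext => y; exact: flowNK.
have E5 : 'd (fun x => flow (- w) (flow w x)) x v = v by rewrite E4; exact: diff_idE.
apply: etrans (esym E5) _; apply: etrans E3 _.
apply: etrans (congr1 (fun u => 'd (flow (- w)) (flow w x) u) D1) _.
exact: linear0.
Qed.

Lemma saturation_biholomorphic : biholomorphic_on F saturation.
Proof.
split; [exact: open_saturation|exact: open_image_saturation| |].
  by move=> x _; exact: dF.
(* Outside the image [G] takes the arbitrary value [p]; differentiability is claimed only on the
   image, which is open. *)
have /choice[G HG] (y : V) : exists x, (F @` saturation) y -> saturation x /\ F x = y.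
  have [[x xs xy]|ny] := pselect ((F @` saturation) y); first by exists x.
  by exists p => /ny.
have GF x : saturation x -> G (F x) = x.
  move=> xs; have [] := HG (F x); first by exists x.
  by move=> gs gE; exact: avg_inj_saturation.
exists G; split; [|exact: GF|by move=> y /HG[]].
move=> _ [x xs <-].
have [w [xd xV]] := xs.
have [K K0 HK] := linear_rV_bounded (lin w).
have du := flow_diff_space act (- w) (flow w x).
have [r r0 Hr] := diff_nrm du ltr01.
have [K' K'0 HK'] := linear_nrm_bounded (diff_continuous du).
have /nbhs_nrmP[s s0 Hs] : nbhs (F x) (lin w @^-1` circle_ball phi p (d / 4)).
  apply: open_nbhs_nbhs; split; last by rewrite /= -(avg_equivariant act fixp).
  apply: open_comp (circle_ball_open act fixp (r := d / 4)) => y _.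
  exact: lin_continuous.
(* Near [F x], [G] is [lin w], then the inverse of [F] on [core], then [flow (- w)]. Their Lipschitz
   constants are [K], 2 and [K' + 1], the last one being the norm of the differential plus the
   remainder. The radius keeps [lin w y] in the circle ball and the increment in [core] below
   [r]. *)
apply: (@inverse_diff _ _ F G x (Num.min s (r / (2 * K))) ((K' + 1) * (2 * K))
  (dF x) (fun v => @avg_diff_inj x v xs) (GF x xs)).
  by rewrite lt_min s0 divr_gt0// mulr_gt0.
move=> y; rewrite lt_min => /andP[ys yr].
have [u uc uE] := core_onto (Hs y ys).
pose x' := flow (- w) u.
have wx' : flow w x' = u by rewrite /x' -{1}[w]opprK (flowNK act).
have xs' : saturation x' by exists w; rewrite wx'.
have Fx' : F x' = y by rewrite (avg_equivariant act fixp) uE (linNK act fixp).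
have Gy : G y = x' by rewrite -Fx' GF.
split; first by rewrite Gy.
have uu : nrm (u - flow w x) <= 2 * K * nrm (y - F x).
  have [ud _] := uc.
  apply: le_trans (near_identity_expanding lipF (ltW ud) (ltW xd)) _.
  rewrite -mulrA ler_pM2l// uE (avg_equivariant act fixp) -linearB.
  exact: HK.
have ur : nrm (u - flow w x) < r.
  by apply: le_lt_trans uu _; move: yr; rewrite ltr_pdivlMr ?mulr_gt0// mulrC.
have := Hr _ ur; rewrite (addrC (flow w x)) subrK (flowNK act) mul1r.
rewrite -[flow (- w) u]/x' -Gy => h1.
have h2 := HK' (u - flow w x).
have : nrm (G y - x) <= (K' + 1) * nrm (u - flow w x).
  rewrite -[G y - x](subrK ('d (flow (- w)) (flow w x) (u - flow w x))).
  by apply: le_trans (nrmD _ _) _; rewrite mulrDl mul1r addrC; exact: lerD.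
move=> /le_trans; apply; rewrite -[leRHS]mulrA ler_wpM2l//.
by rewrite addr_ge0// ltW.
Qed.

End Saturation.

Theorem theoremA (R : realType) (n : nat)
  (phi : CxCn R n -> Cn R n) (p : Cn R n) :
  holomorphic_Cstar_action phi -> fixed_point phi p ->
  exists F : Cn R n -> Cn R n,
    [/\ holomorphic_on F setT,
        F p = 0,
        (forall z : R[i], z != 0 ->
           linearized_action phi p z \o F = F \o slice phi z) &
        exists W : set (Cn R n),
          [/\ open W, W p, phi_invariant phi W & biholomorphic_on F W]].
Proof.
move=> act fixp; exists (avg phi p); split.
- by move=> x _; exact: avg_diff.
- exact: avg_fixed.
- move=> z /cexp_surj[w <-]; apply/funext => x.
  exact (esym (avg_equivariant act fixp w x)).
have [d d0 lipF] := near_identity_lipschitz (avg_diff act fixp) (avg_fixed fixp)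
  (avg_derivative act fixp).
exists (saturation phi p d); split.
- exact: open_saturation.
- by exists 0; rewrite (flow0 act); exact: core_fixed.
- by move=> z x /cexp_surj[w <-]; exact: flow_saturation.
- exact: saturation_biholomorphic.
Qed.
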